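(* For every integer partition $\lambda=(\lambda_1,\ldots,\lambda_{l(\lambda)})$, the coefficient $b_\lambda(\Gamma)$ in front of the Chern number $C_\lambda[\cdot]$ in the $\Gamma$-genus is given by $$b_\lambda(\Gamma)=\frac{1}{\prod_i m_i(\lambda)!}\sum_{\pi\in\Pi_{l(\lambda)}}\left\{(-1)^{l(\lambda)-l(\pi)}\prod_{i=1}^{l(\pi)}\left[(|\pi_i|-1)!\cdot\zeta(\lambda_{\pi_i})\right]\right\},$$ with the convention $\zeta(1):=\gamma$. If $m_1(\lambda)=0$, then moreover $$b_\lambda(\Gamma)=\frac{\zeta_S(\lambda_1,\ldots,\lambda_{l(\lambda)})}{\prod_i m_i(\lambda)!}.$$ In the first identity, $\zeta(\lambda_{\pi_i})=\gamma$ occurs if and only if $|\pi_i|=1$, say $\pi_i=\{j\}$, and $\lambda_j=1$. In particular, the second identity holds true for Calabi-Yau manifolds (for a Calabi-Yau manifold, only Chern numbers $C_\lambda$ with $m_1(\lambda)=0$ are involved).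
   Context: An integer partition $\lambda=(\lambda_1,\ldots,\lambda_{l})$ is a finite sequence of positive integers $\lambda_1\ge\cdots\ge\lambda_l\ge1$; $l(\lambda)=l$ is its length, $|\lambda|=\sum_i\lambda_i$ its weight, and $m_i(\lambda)$ is the number of parts equal to $i$; $0!:=1$. $\Pi_r$ denotes the set of all partitions of the set $\{1,\ldots,r\}$ into disjoint nonempty blocks; for $\pi=\{\pi_1,\ldots,\pi_{l(\pi)}\}\in\Pi_r$, the $\pi_i$ are its blocks and $l(\pi)$ is the number of blocks; for $\pi\in\Pi_{l(\lambda)}$, $\lambda_{\pi_i}:=\sum_{j\in\pi_i}\lambda_j$. Complex genera: a complex genus $\varphi$ corresponds to a formal power series $Q(x)=1+\sum_{i\ge1}a_ix^i$. The coefficients $b_\lambda(\varphi)$, indexed by integer partitions $\lambda$, are defined by the expansion $$\prod_{i=1}^\infty Q(x_i)=1+\sum_{|\lambda|\ge1}b_\lambda(\varphi)\,e_\lambda(\mathbf{x}),\qquad e_\lambda=\prod_{i=1}^{l(\lambda)}e_{\lambda_i},$$ where $e_k=e_k(x_1,x_2,\ldots)$ is the $k$-th elementary symmetric function in countably many commuting variables. For a compact almost-complex manifold $M$ of real dimension $2n$ with Chern classes $c_i$, $\varphi(M)=\sum_{|\lambda|=n}b_\lambda(\varphi)C_\lambda[M]$, where $C_\lambda[M]=\int_M c_{\lambda_1}\cdots c_{\lambda_{l(\lambda)}}$ is the Chern number. The $\Gamma$-genus is the complex genus (with real coefficients) whose power series is $$Q(x)=\frac{1}{\Gamma(1+x)}=\exp(\gamma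 x)\prod_{i=1}^\infty\left[\left(1+\frac{x}{i}\right)\exp\left(-\frac{x}{i}\right)\right],$$ expanded at $x=0$, where $\gamma=\lim_{n\to\infty}\left[\sum_{i=1}^n\frac1i-\ln n\right]$ is the Euler constant. $\zeta(t)=\sum_{n\ge1}n^{-t}$ for $t>1$; for real $t_1,\ldots,t_r>1$, $$\zeta(t_1,\ldots,t_r)=\sum_{n_1>n_2>\cdots>n_r\ge1}\frac{1}{n_1^{t_1}\cdots n_r^{t_r}},\qquad \zeta_S(t_1,\ldots,t_r)=\sum_{\sigma\in S_r}\zeta(t_{\sigma(1)},\ldots,t_{\sigma(r)}),$$ where $S_r$ is the permutation group of $\{1,\ldots,r\}$. A Calabi-Yau manifold is meant in the weak sense that its first Chern class is a torsion element. *)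

(* Defs.v *)
From HB Require Import structures.
From mathcomp Require Import all_boot all_order all_algebra all_fingroup finmap.
From mathcomp Require Import all_classical all_reals all_analysis.

Set Implicit Arguments.
Unset Strict Implicit.
Unset Printing Implicit Defensive.

Import Order.TTheory GRing.Theory Num.Theory.
Import numFieldNormedType.Exports.

Local Open Scope classical_set_scope.
Local Open Scope ring_scope.

Definition is_intpart (s : seq nat) : bool :=
  sorted geq s && all (leq 1) s.

Record intpart := IntPart { parts :> seq nat; _ : is_intpart parts }.
HB.instance Definition _ := [isSub for parts].
HB.instance Definition _ := [Choice of intpart by <:].

Definition plength (la : intpart) : nat := size la.
Definition weight (la : intpart) : nat := sumn la.
Definition mult (i : nat) (la : intpart) : nat := count_mem i la.
Definition part (la : intpart) (j : 'I_(plength la)) : nat := nth 0%N la j.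

(* The factors with m_i = 0 are 0! = 1, so i only ranges over the parts. *)
Definition mult_fact (la : intpart) : nat :=
  (\prod_(i <- undup la) (mult i la)`!)%N.

(* A monomial is its finitely supported exponent vector, a formal power series
   is its family of coefficients. *)
Definition monom := {fsfun nat -> nat with 0%N}.

Section MultivariateSeries.
Variable R : realType.

Definition mps := monom -> R.

Definition mps_one : mps := fun m => (finsupp m == fset0)%:R.

Definition mps_mul (f g : mps) : mps := fun m =>
  \sum_(p \in [set p : monom * monom | forall i, m i = (p.1 i + p.2 i)%N])
    f p.1 * g p.2.

(* e_k is the sum of all squarefree monomials of degree k. *)
Definition elem_sym (k : nat) : mps := fun m =>
  ((#|` finsupp m| == k) && all (fun i => m i == 1%N) (finsupp m))%:R.

Definition elem_sym_part (la : intpart) : mps :=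
  foldr (fun k f => mps_mul (elem_sym k) f) mps_one la.

(* Q(x_i), where Q(x) = \sum_k a_k x^k. *)
Definition mps_subst (a : nat -> R) (i : nat) : mps := fun m =>
  if all (fun j => j == i) (finsupp m) then a (m i) else 0.

(* \prod_i Q(x_i): every coefficient of the finite partial products is
   eventually constant when a_0 = 1. *)
Definition mps_prod (a : nat -> R) : mps := fun m =>
  limn (fun N => foldr (fun i f => mps_mul (mps_subst a i) f) mps_one
                       (iota 0 N) m).

(* The sum has finite support: the coefficient of e_la at m vanishes unless
   weight la is the degree of m. *)
Definition genus_expansion (a : nat -> R) (b : intpart -> R) : Prop :=
  (forall la, weight la = 0%N -> b la = 1) /\
  (forall m : monom,
     mps_prod a m = mps_one m +
       \sum_(la \in [set la | (1 <= weight la)%N]) b la * elem_sym_part la m).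

(* The family b_la(phi) of the genus phi with power series \sum_k a_k x^k; the
   default value of xget is irrelevant when a_0 = 1, since the products e_la
   form a topological basis of the symmetric power series. *)
Definition genus_coef (a : nat -> R) : intpart -> R :=
  xget (fun=> 0) [set b | genus_expansion a b].

End MultivariateSeries.

(* Integral cohomological data of a compact almost-complex manifold M of real
   dimension 2n: the even cohomology ring (commutative), its graded pieces
   [coh_deg k] = H^{2k}(M; Z), the Chern classes, and evaluation on the
   fundamental class. *)
Record chern_data := ChernData {
  half_dim : nat;
  even_coh : comPzRingType;
  coh_deg : nat -> set even_coh;
  chern : nat -> even_coh;
  fund_eval : {additive even_coh -> int};
  coh_deg0 : forall k, coh_deg k 0;
  coh_degB : forall k x y, coh_deg k x -> coh_deg k y -> coh_deg k (x - y);
  coh_deg1 : coh_deg 0%N 1;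
  coh_degM : forall j k x y,
    coh_deg j x -> coh_deg k y -> coh_deg (j + k)%N (x * y);
  chern_deg : forall k, coh_deg k (chern k);
  chern0 : chern 0%N = 1;
  chern_gt : forall k, (half_dim < k)%N -> chern k = 0;
  fund_eval_deg : forall k x, k != half_dim -> coh_deg k x -> fund_eval x = 0
}.

Definition chern_number (la : intpart) (M : chern_data) : int :=
  fund_eval M (\prod_(k <- la) chern M k).

Definition calabi_yau (M : chern_data) : Prop :=
  exists k : nat, (0 < k)%N /\ chern M 1%N *+ k = 0.

Section GammaGenus.
Variable R : realType.

Definition complex_genus (a : nat -> R) (M : chern_data) : R :=
  \sum_(la \in [set la | weight la = half_dim M])
    genus_coef a la * (chern_number la M)%:~R.

Definition euler_gamma : R :=
  limn (fun n => \sum_(1 <= i < n.+1) (i%:R)^-1 - ln n%:R).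

(* 1 / Gamma(1 + x), by its Weierstrass product. *)
Definition inv_Gamma1 (x : R) : R :=
  expR (euler_gamma * x) *
  limn (fun N => \prod_(1 <= i < N.+1) ((1 + x / i%:R) * expR (- (x / i%:R)))).

Definition taylor_coef (f : R -> R) (n : nat) : R :=
  derive1n n f 0 / n`!%:R.

Definition Gamma_series : nat -> R := taylor_coef inv_Gamma1.

Definition zeta (t : R) : R := limn (series (fun n => n.+1%:R `^ (- t))).

Definition zetac (k : nat) : R := if k == 1%N then euler_gamma else zeta k%:R.

Definition mzeta (r : nat) (t : 'I_r -> R) : R :=
  fine (\esum_(n in [set n : {ffun 'I_r -> nat} |
                      (forall i j : 'I_r, (i < j)%N -> (n j < n i)%N) /\
                      (forall i : 'I_r, (1 <= n i)%N)])
          (\prod_(i < r) (n i)%:R `^ (- t i))%:E).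

Definition zetaS (r : nat) (t : 'I_r -> R) : R :=
  \sum_(s : 'S_r) mzeta (fun i => t (s i)).

End GammaGenus.

Definition set_partition (r : nat) (P : {set {set 'I_r}}) : bool :=
  finset.partition P (finset.setTfor 'I_r).

Definition block_sum (la : intpart) (B : {set 'I_(plength la)}) : nat :=
  (\sum_(j in B) part j)%N.

(* Main.v *)
Require Import Defs.
From HB Require Import structures.
From mathcomp Require Import all_boot all_order all_algebra all_fingroup finmap.
From mathcomp Require Import all_classical all_reals all_analysis.
From mathcomp Require Import ring lra zify complex.

Import Order.TTheory GRing.Theory Num.Theory.
Import numFieldNormedType.Exports.

Set Implicit Arguments.
Unset Strict Implicit.
Unset Printing Implicit Defensive.

(** The power series of the genus is a product of linear factors, up to any
    fixed degree: over an algebraically closed field there are y_1, ..., y_n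
    whose elementary symmetric values are its first coefficients, so that
    modulo higher degree Q(x) is the product of the 1 + y_j x.  Then the
    product of the Q(x_i) is the product of all the 1 + x_i y_j, and
    multiplying out one y_j at a time, each step being a multiplication by
    1 + y e_1 + y^2 e_2 + ..., expresses it in the e_la with coefficient the
    monomial symmetric function m_la(y) (prod_elem_val_expansion, the dual
    Cauchy identity).

    The number m_la(y) is 1 / prod_i m_i(la)! times the sum of the products of
    the y_f(i)^la_i over injective maps f.  Moebius inversion on the lattice of
    set partitions turns such a sum over injective maps into an alternating sum
    of products of power sums of y (inj_sum_partition).  By Newton's identities
    the power sums of y depend on the coefficients of Q alone
    (newton_power_sum), which makes the result a formula over the base field.
    Since e_la has a positive coefficient on a monomial where only the e_mu
    with mu dominated by la can be nonzero, the coefficients of such an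
    expansion are unique (genus_expansion_inj), and the formula computes
    genus_coef.

    For the Gamma genus the relevant power sums are the zeta values.  Near 0
    the Weierstrass product is the exponential of the power series with
    derivative gamma - zeta(2) x + zeta(3) x^2 - ..., and taking Taylor
    coefficients in f' = h f yields exactly Newton's identities with power sums
    gamma, zeta(2), zeta(3), ... (newton_related_Gamma).  This is the first
    identity.

    For the second one, the same Moebius inversion is applied to the numbers
    1, 1/2, ..., 1/N.  Sorting the values of an injective map splits the sum
    over injective maps into the truncations of the multiple zeta values of all
    the rearrangements of la.  When all parts are at least 2 both sides
    converge as N grows, and the limit is the identity between zetaS and the
    alternating sum (zetaS_moebius).

    Finally gamma <= 1 < zeta(k) for k >= 2, so gamma occurs only from a block
    sum equal to 1, and a torsion first Chern class kills every Chern number in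
    which c_1 is a factor, because Chern numbers are integers. *)

Local Open Scope ring_scope.

(** * Sums over set partitions and over injective maps *)

Section Combinatorics.
(* The finite-set meaning of names that classical sets also use. *)
Import mathcomp.boot.fintype mathcomp.boot.finset.

Lemma setU1D1_eq (T : finType) (x : T) (A : {set T}) :
  ((x |: A) :\ x == A) = (x \notin A).
Proof.
apply/eqP/idP => [<-|]; last exact: setU1K.
by rewrite in_setD1 eqxx.
Qed.

Section PartitionSums.
Variables (F : comNzRingType) (T : finType).
Implicit Types (D B C : {set T}) (P : {set {set T}}) (w : {set T} -> F).

Definition partition_sum w D : F :=
  \sum_(P | partition P D) \prod_(B in P) w B.

Lemma partition_sum0 w : partition_sum w set0 = 1.
Proof.
rewrite /partition_sum (eq_bigl (pred1 set0)); last first.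
  by move=> P; rewrite partition_set0.
by rewrite big_pred1_eq big_set0.
Qed.

(** A partition of D is determined by the block C of a chosen element x and by
    a partition of the rest; this is the recursion through which sums over set
    partitions are computed below. *)
Lemma partition_sum_rec w D x : x \in D ->
  partition_sum w D =
  \sum_(C : {set T} | (C \subset D) && (x \in C))
     w C * partition_sum w (D :\: C).
Proof.
move=> xD; rewrite /partition_sum.
rewrite (partition_big (fun P : {set {set T}} => pblock P x)
   (fun C : {set T} => (C \subset D) && (x \in C))) /=; last first.
  move=> P partP; have covP := cover_partition partP.
  have Px : pblock P x \in P by rewrite pblock_mem // covP.
  have sub : pblock P x \subset cover P.
    exact: (bigcup_sup _ Px).
  by rewrite mem_pblock; move: sub; rewrite covP xD => ->.
apply: eq_bigr => C /andP[CD xC]; rewrite mulr_sumr.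
have C0 : C != set0 by apply/set0Pn; exists x.
have disC : [disjoint C & D :\: C].
  by rewrite disjoint_sym disjoints_subset subDset setUC -subDset setDE setCK subsetIr.
have CN P : partition P (D :\: C) -> C \notin P.
  move=> partP; apply/negP => CP.
  have : C \subset D :\: C by rewrite -(cover_partition partP); exact: (bigcup_sup _ CP).
  by move/subsetP/(_ x xC); rewrite in_setD xC.
rewrite (reindex_onto (fun P => C |: P) (fun P => P :\ C)) /=; last first.
  move=> P /andP[partP /eqP PxC]; apply: setD1K.
  by rewrite -PxC pblock_mem // (cover_partition partP).
apply: eq_big => [P|P /andP[_ /eqP PC]]; last first.
  rewrite big_setU1 // -PC in_setD1 eqxx //.
apply/andP/idP => [[/andP[partP _] /eqP <-]|partP].
  by apply: partitionD1; rewrite ?in_setU1 ?eqxx.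
have partCP : partition (C |: P) D.
  rewrite -(setID D C) (setIidPr CD).
  exact: partitionU1.
split; last by rewrite setU1K // CN.
rewrite partCP /=; apply/eqP/def_pblock => //; first by case/and3P: partCP.
by rewrite in_setU1 eqxx.
Qed.

End PartitionSums.

Section InjectiveSums.
Variables (F : comNzRingType) (T : finType).
Implicit Types (D B C : {set T}) (ys : seq F) (la : T -> nat).

Definition power_sum ys k : F := \sum_(y <- ys) y ^+ k.

(** The sum, over injective maps f from D to the positions of ys, of the
    products of the ys_f(i)^(la i). The recursion asks which element of D, if
    any, is sent to the first position. *)
Fixpoint inj_sum la ys D : F :=
  if ys is y :: ys' then
    inj_sum la ys' D + \sum_(z in D) y ^+ la z * inj_sum la ys' (D :\ z)
  else (D == set0)%:R.

(** The same sum with one additional element, of exponent k, adjoined to D.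
    Keeping that exponent as a parameter allows it to absorb the exponents of
    elements of D. *)
Fixpoint inj_sum_mark la ys k D : F :=
  if ys is y :: ys' then
    inj_sum_mark la ys' k D + y ^+ k * inj_sum la ys' D
    + \sum_(z in D) y ^+ la z * inj_sum_mark la ys' k (D :\ z)
  else 0.

Lemma inj_sumU1 la ys x D : x \notin D ->
  inj_sum la ys (x |: D) = inj_sum_mark la ys (la x) D.
Proof.
elim: ys D => [|y ys IH] D xD /=.
  have /negPf-> // : x |: D != set0.
  by apply/set0Pn; exists x; rewrite in_setU1 eqxx.
rewrite IH // big_setU1 //= setU1K // addrA; congr (_ + _).
apply: eq_bigr => z zD; rewrite -IH; last first.
  by rewrite in_setD1 (negPf xD) andbF.
congr (_ * inj_sum _ _ _); apply/setP => u; rewrite !inE.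
by case: (eqVneq u x) => // ->; case: (eqVneq x z) => // xz; rewrite xz zD in xD.
Qed.

(** In the product of a power sum with a sum over injective maps, the free
    index either avoids the image of f or coincides with f(z) for exactly one
    z in D; in the latter case the two exponents add up. *)
Lemma power_sum_mul_inj_sum la ys k D :
  power_sum ys k * inj_sum la ys D =
  inj_sum_mark la ys k D
    + \sum_(z in D) inj_sum_mark la ys (k + la z) (D :\ z).
Proof.
elim: ys D => [|y ys IH] D.
  by rewrite /power_sum big_nil mul0r /= add0r big1.
rewrite /power_sum big_cons -/(power_sum ys k) mulrDl /=.
rewrite mulrDr (mulrDr (power_sum ys k)) IH mulr_sumr mulr_sumr.
rewrite [X in _ + (_ + X)](_ : _ =
   \sum_(z in D) y ^+ la z * inj_sum_mark la ys k (D :\ z) +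
   \sum_(z in D) \sum_(u in D :\ z) y ^+ la u *
      inj_sum_mark la ys (k + la z)%N (D :\ z :\ u)); last first.
  rewrite [X in _ = _ + X](exchange_big_dep (mem D)) /=; last first.
    by move=> z u _; rewrite in_setD1 => /andP[].
  rewrite -big_split /=; apply: eq_bigr => u uD.
  rewrite mulrCA IH mulrDr mulr_sumr; congr (_ + _).
  apply: eq_big => [z|z zD]; first by rewrite !in_setD1 uD andbT eq_sym andbC.
  by congr (_ * inj_sum_mark _ _ _ _); apply/setP => v; rewrite !inE andbCA.
rewrite [X in _ = _ + X]big_split big_split /=.
rewrite [X in X + _ = _](_ : _ = y ^+ k * inj_sum la ys D +
   \sum_(z in D) y ^+ (k + la z) * inj_sum la ys (D :\ z)); last first.
  by congr (_ + _); apply: eq_bigr => z _; rewrite exprD mulrA.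
set a := _ * inj_sum _ _ _; set b := \sum_(z in D) _; set c := inj_sum_mark _ _ _ _.
set d := \sum_(z in D) _; set e := \sum_(z in D) _; set f := \sum_(z in D) _.
clearbody a b c d e f; ring.
Qed.

(** Unrolling the previous relation merges elements of D one after the other
    with the marked one. The set C of merged elements is reached in |C|!
    orders, each of sign (-1)^|C|. *)
Lemma inj_sum_mark_expand la ys k D :
  inj_sum_mark la ys k D =
  \sum_(C : {set T} | C \subset D) (-1) ^+ #|C| * (#|C|)`!%:R *
    power_sum ys (k + \sum_(i in C) la i) * inj_sum la ys (D :\: C).
Proof.
move: {2}#|D| (eqxx #|D|) => n; elim: n D k => [|n IH] D k.
  rewrite cards_eq0 => /eqP ->.
  rewrite (eq_bigl (pred1 set0)); last by move=> C; rewrite subset0.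
  rewrite big_pred1_eq cards0 big_set0 setD0 addn0 expr0 mul1r mul1r.
  by rewrite power_sum_mul_inj_sum big_set0 addr0.
move=> /eqP cD.
have := power_sum_mul_inj_sum la ys k D => /esym/(canRL (addrK _)) ->.
rewrite [RHS](bigD1 set0) ?sub0set //=.
rewrite cards0 big_set0 setD0 addn0 expr0 !mul1r; congr (_ + _).
rewrite -sumrN.
transitivity (\sum_(z in D) \sum_(C : {set T} | (C \subset D) && (z \in C))
   ((-1) ^+ #|C| * (#|C|.-1)`!%:R *
    power_sum ys (k + \sum_(i in C) la i) * inj_sum la ys (D :\: C))).
  apply: eq_bigr => z zD; rewrite IH; last first.
    by move: cD; rewrite (cardsD1 z) zD add1n => -[->].
  rewrite [RHS](reindex_onto (fun C => z |: C) (fun C => C :\ z)) /=; last first.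
    by move=> C /andP[_ zC]; rewrite setD1K.
  rewrite -sumrN.
  have zN C : (C \subset D :\ z) = (C \subset D) && (z \notin C).
    by rewrite subsetD1.
  apply: eq_big => [C|C].
    rewrite zN setU11 andbT subUset sub1set zD /=; congr (_ && _).
    by rewrite setU1D1_eq //.
  rewrite zN => /andP[CD zC].
  rewrite cardsU1 zC big_setU1 //= add1n exprS mulN1r !mulNr.
  rewrite addnA; congr (- (_ * inj_sum _ _ _)).
  by apply/setP => u; rewrite !inE negb_or; case: (u == z); rewrite ?andbF.
(* Each nonempty C now occurs once for every z in C, taken as the element that
   is merged first: (|C| - 1)! becomes |C|!. *)
rewrite (exchange_big_dep (fun C : {set T} => (C \subset D) && (C != set0))) /=.
  apply: eq_bigr => C /andP[CD C0].
  rewrite (eq_bigl (mem C)); last first.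
    by move=> z; rewrite CD /=; case zC: (z \in C); rewrite ?andbF // (subsetP CD).
  have -> : (#|C|)`! = (#|C| * (#|C|.-1)`!)%N.
    by rewrite -card_gt0 in C0; case: #|C| C0 => // m _; rewrite factS.
  rewrite sumr_const -[LHS]mulr_natl natrM !mulrA; congr (_ * _ * _ * _); exact: mulrC.
by move=> z C zD /andP[-> zC]; apply/set0Pn; exists z.
Qed.

(** The relation above, applied to a chosen x in D, is the recursion of
    partition_sum_rec with C the rest of the block of x, of weight (-1)^(|B| -
    1) (|B| - 1)!. *)
Lemma inj_sum_partition la ys D :
  inj_sum la ys D =
  partition_sum (fun B => (-1) ^+ #|B|.-1 * (#|B|.-1)`!%:R *
                     power_sum ys (\sum_(i in B) la i)) D.
Proof.
move: {2}#|D|.+1 (ltnSn #|D|) => n; elim: n D => // n IH D; rewrite ltnS => cD.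
have [->|[x xD]] := set_0Vmem D.
  rewrite partition_sum0; elim: ys {IH} => /= [|y ys ->]; first by rewrite eqxx.
  by rewrite big_set0 addr0.
rewrite (partition_sum_rec _ xD) -{1}(setD1K xD) inj_sumU1; last first.
  by rewrite in_setD1 eqxx.
rewrite inj_sum_mark_expand.
rewrite [RHS](reindex_onto (fun C => x |: C) (fun C => C :\ x)) /=; last first.
  by move=> C /andP[_ xC]; rewrite setD1K.
apply: eq_big => [C|C].
  rewrite subsetD1 setU11 andbT subUset sub1set xD /=; congr (_ && _).
  by rewrite setU1D1_eq.
rewrite subsetD1 => /andP[CD xC].
rewrite cardsU1 xC big_setU1 //=; congr (_ * _).
rewrite (_ : D :\ x :\: C = D :\: (x |: C)); last first.
  by apply/setP => u; rewrite !inE negb_or; case: (u == x); rewrite ?andbF.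
apply: IH; apply: leq_trans cD; apply: proper_card.
apply/properP; split; first exact: subsetDl.
by exists x => //; rewrite !inE eqxx.
Qed.

End InjectiveSums.

End Combinatorics.

(** * Elementary symmetric values and Newton's identities *)

Section Newton.
Variable F : comNzRingType.
Implicit Types (ys : seq F) (k : nat).

(** The elementary symmetric functions of ys. *)
Fixpoint elem_val ys k : F :=
  if ys is y :: ys' then
    elem_val ys' k + (if k is k'.+1 then y * elem_val ys' k' else 0)
  else (k == 0%N)%:R.

Lemma elem_val0 ys : elem_val ys 0 = 1.
Proof. by elim: ys => //= y ys ->; rewrite addr0. Qed.

Lemma elem_val_gt ys k : (size ys < k)%N -> elem_val ys k = 0.
Proof.
elim: ys k => [|y ys IH] [|k] //=; rewrite ltnS => ysk.
by rewrite IH ?IH ?mulr0 ?addr0 // ltnW.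
Qed.

(** Evaluation on ys of the relation between coefficients and roots, with
    signs removed by taking the roots to be the opposites of ys. *)
Lemma elem_val_coef ys k : (k <= size ys)%N ->
  (\prod_(y <- ys) ('X + y%:P))`_(size ys - k) = elem_val ys k.
Proof.
elim: ys k => [|y ys IH] k; first by rewrite leqn0 => /eqP ->; rewrite big_nil coefC.
have sz : size (\prod_(y <- ys) ('X + y%:P)) = (size ys).+1.
  rewrite (eq_bigr (fun y => 'X - (- y)%:P)); last by move=> z _; rewrite polyCN opprK.
  by rewrite size_prod_XsubC.
rewrite big_cons mulrDl coefD coefXM coefCM /=.
case: k => [_|k ky].
  rewrite subn0 /= -[X in _`_X](subn0 (size ys)) IH // elem_val0.
  by rewrite nth_default ?sz // mulr0.
rewrite subSS subn_eq0; move: ky; rewrite ltnS leq_eqVlt.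
have [->|ky] /= := eqVneq k (size ys).
  by rewrite leqnn elem_val_gt // !add0r -IH // => _.
by move=> ky'; rewrite leqNgt ky' /= -(IH k.+1) // -(IH k) ?(ltnW ky') // subnS addrC.
Qed.

(** The coefficient of x^(k+1) in y x / (1 + y x) times the generating
    function of elem_val (y :: ys), whose factor 1 + y x cancels the
    denominator. *)
Lemma geometric_elem_val y ys k :
  \sum_(i < k.+1) (-1) ^+ i * y ^+ i.+1 * elem_val (y :: ys) (k - i)
    = y * elem_val ys k.
Proof.
elim: k => [|k IH].
  by rewrite big_ord1 expr0 mul1r expr1 subnn /= addr0.
rewrite big_ord_recl expr0 mul1r expr1 subn0 /=.
rewrite (eq_bigr (fun i : 'I_k.+1 =>
   - y * ((-1) ^+ i * y ^+ i.+1 * elem_val (y :: ys) (k - i)))); last first.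
  by move=> i _; rewrite /bump /= add1n subSS /= !exprS; ring.
by rewrite -mulr_sumr IH /=; ring.
Qed.

Lemma newton_elem_val ys k :
  k.+1%:R * elem_val ys k.+1 =
  \sum_(i < k.+1) (-1) ^+ i * power_sum ys i.+1 * elem_val ys (k - i).
Proof.
elim: ys k => [|y ys IH] k.
  by rewrite mulr0 big1 // => i _; rewrite /power_sum big_nil mulr0 mul0r.
rewrite (eq_bigr (fun i : 'I_k.+1 =>
    (-1) ^+ i * power_sum ys i.+1 * elem_val ys (k - i)
    + (-1) ^+ i * power_sum ys i.+1 *
        (if (k - i)%N is j.+1 then y * elem_val ys j else 0)
    + (-1) ^+ i * y ^+ i.+1 * elem_val (y :: ys) (k - i))); last first.
  move=> i _; rewrite {1}/power_sum big_cons (addrC (y ^+ _)) (mulrDr ((-1) ^+ i)) mulrDl; congr (_ + _).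
  by rewrite -mulrDr.
rewrite !big_split /= -IH geometric_elem_val.
rewrite mulrDr -addrA; congr (_ + _).
case: k => [|k]; first by rewrite big_ord1 subnn mulr0 add0r mul1r.
rewrite big_ord_recr /= subnn mulr0 addr0.
rewrite (eq_bigr (fun i : 'I_k.+1 =>
   y * ((-1) ^+ i * power_sum ys i.+1 * elem_val ys (k - i)))); last first.
  by move=> i _; rewrite subSn 1?mulrCA // -ltnS.
by rewrite -mulr_sumr -IH mulrCA -mulrDr -[X in _ = _ * (_ + X)]mul1r -mulrDl natr1.
Qed.

(** Newton's identities are triangular in the power sums with leading
    coefficient a sign, so they determine the power sums from the elementary
    values in any characteristic. *)
Lemma newton_power_sum ys (a c : nat -> F) d :
  (forall k, (k <= d)%N -> elem_val ys k = a k) ->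
  (forall k, k.+1%:R * a k.+1 =
     \sum_(i < k.+1) (-1) ^+ i * c i.+1 * a (k - i)%N) ->
  forall k, (k < d)%N -> power_sum ys k.+1 = c k.+1.
Proof.
move=> ya ac k; have [n] := ubnP k; elim: n k => // n IH k; rewrite ltnS => kn kd.
have := newton_elem_val ys k; rewrite ya // ac !big_ord_recr /= subnn.
rewrite (eq_bigr (fun i : 'I_k =>
   (-1) ^+ i * power_sum ys i.+1 * elem_val ys (k - i))); last first.
  move=> i _; rewrite IH ?(leq_trans _ kn) ?(ltn_trans _ kd) // ya //.
  by rewrite (leq_trans (leq_subr _ _)) // ltnW.
move/addrI; rewrite elem_val0 -ya // elem_val0 !mulr1 => /(congr1 (fun z => (-1) ^+ k * z)).
by rewrite !mulrA -exprMn mulrNN mul1r expr1n !mul1r => <-.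
Qed.

End Newton.

(** The y are the opposites of the roots of the reversed truncated series,
    which is monic because a 0 = 1. *)
Lemma exists_elem_val (F : closedFieldType) (a : nat -> F) d : a 0%N = 1 ->
  exists ys : seq F, forall k, (k <= d)%N -> elem_val ys k = a k.
Proof.
move=> a0; pose p := \poly_(i < d.+1) a (d - i)%N.
have szp : size p = d.+1 by rewrite size_poly_eq // subnn a0 oner_eq0.
have lp : lead_coef p = 1 by rewrite lead_coefE szp coef_poly ltnSn subnn.
have [r pr] := closed_field_poly_normal p.
rewrite lp scale1r in pr.
have pE : p = \prod_(y <- [seq - z | z <- r]) ('X + y%:P).
  by rewrite pr big_map; apply: eq_bigr => z _; rewrite polyCN.
have szr : size [seq - z | z <- r] = d.
  by apply/eqP; rewrite size_map -eqSS -szp pr size_prod_XsubC.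
exists [seq - z | z <- r] => k kd; rewrite -elem_val_coef ?szr // -pE.
by rewrite coef_poly ltnS leq_subr subKn.
Qed.

(** * Monomials and the algebra of power series *)

Section Monomials.
Implicit Types (m p q : monom) (s : seq nat) (i k : nat).

Definition mono0 : monom := [fsfun].
Definition mono_add p q : monom :=
  [fsfun i in (finsupp p `|` finsupp q)%fset => (p i + q i)%N].
Definition mono_sub m p : monom := [fsfun i in finsupp m => (m i - p i)%N].

Lemma mono0E i : mono0 i = 0%N. Proof. exact: fsfun0E. Qed.

Lemma mono_notin m i : i \notin finsupp m -> m i = 0%N.
Proof. exact: fsfun_dflt. Qed.

Lemma mono_addE p q i : mono_add p q i = (p i + q i)%N.
Proof.
rewrite fsfunE in_fsetU; case: (finsuppP p) => //=; case: (finsuppP q) => //=.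
Qed.

Lemma mono_subE m p i : mono_sub m p i = (m i - p i)%N.
Proof. by rewrite fsfunE; case: (finsuppP m) => //=. Qed.

Lemma mono_finsupp m i : (i \in finsupp m) = (0 < m i)%N.
Proof. by rewrite mem_finsupp lt0n. Qed.

Lemma mono_addC p q : mono_add p q = mono_add q p.
Proof. by apply/fsfunP => i; rewrite !mono_addE addnC. Qed.

Lemma finsupp_mono_eq0 m : (finsupp m == fset0) = (m == mono0).
Proof.
apply/eqP/eqP => [m0|->]; last exact: finsupp0.
by apply/fsfunP => i; rewrite mono0E mono_notin // m0 inE.
Qed.

(** Exponents vanish off the support, so an operation over the support may be
    extended to any larger set of variables. This gives several monomials a
    common index set. *)
Lemma big_finsupp_widen (V : Type) (idx : V) (op : Monoid.com_law idx) s m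
    (G : nat -> nat -> V) :
  uniq s -> {subset finsupp m <= s} -> (forall i, G i 0%N = idx) ->
  \big[op/idx]_(i <- s) G i (m i) = \big[op/idx]_(i <- finsupp m) G i (m i).
Proof.
move=> us ms G0; rewrite (bigID (fun i => i \in finsupp m)) /=.
rewrite [X in op _ X]big1 ?Monoid.mulm1 => [|i im]; last first.
  by rewrite mono_notin.
rewrite -big_filter; apply: perm_big; apply: uniq_perm.
- exact: filter_uniq.
- exact: fset_uniq.
- by move=> i; rewrite mem_filter; case im: (i \in finsupp m); rewrite //= ms.
Qed.

(** The divisors of m in the variables of s, listed exponent by exponent: this
    shape makes products of sums expand by induction on s. *)
Fixpoint submonos s m : seq monom :=
  if s is i :: s' then
    [seq [fsfun p with i |-> k] | k <- iota 0 (m i).+1, p <- submonos s' m]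
  else [:: mono0].

Lemma submonos_cons i s m : submonos (i :: s) m =
  [seq [fsfun p with i |-> k] | k <- iota 0 (m i).+1, p <- submonos s m].
Proof. by []. Qed.

Lemma submonosP s m p : uniq s ->
  reflect (forall i, p i <= (if i \in s then m i else 0))%N (p \in submonos s m).
Proof.
elim: s p => [|i s IH] p.
  move=> _; rewrite inE; apply: (iffP eqP) => [-> j|p0]; first by rewrite mono0E.
  by apply/fsfunP => j; apply/eqP; rewrite mono0E -leqn0 p0.
rewrite cons_uniq => /andP[si us].
apply: (iffP idP) => [/allpairsP[[k q] [km qs ->]] j|ple].
  rewrite mem_iota in km.
  rewrite fsfun_withE inE; case: eqP => [->|_] /=; last exact: (IH q us qs).
  by rewrite -ltnS.
apply/allpairsP; exists (p i, [fsfun p with i |-> 0%N]); split.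
- by have := ple i; rewrite inE eqxx mem_iota ltnS.
- apply/(IH _ us) => j /=; rewrite fsfun_withE; case: (eqVneq j i) => // ji.
  by have := ple j; rewrite inE (negPf ji).
- by apply/fsfunP => j /=; rewrite !fsfun_withE; case: (eqVneq j i) => // ->.
Qed.

Lemma submonos_uniq s m : uniq s -> uniq (submonos s m).
Proof.
elim: s => // i s IH; rewrite cons_uniq => /andP[si us].
apply: allpairs_uniq; [exact: iota_uniq|exact: IH|].
move=> [k p] [k' p'] /allpairsPdep[a [b [_ ps [-> ->]]]].
move=> /allpairsPdep[a' [b' [_ ps' [-> ->]]]] /= E.
have E' j : [fsfun b with i |-> a] j = [fsfun b' with i |-> a'] j by rewrite E.
congr (_, _); first by have := E' i; rewrite !fsfun_with.
apply/fsfunP => j; have := E' j; rewrite !fsfun_withE.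
case: (eqVneq j i) => // -> _.
have /submonosP/(_ i) := ps; have /submonosP/(_ i) := ps'.
by rewrite (negPf si) !leqn0 => /(_ us)/eqP-> /(_ us)/eqP->.
Qed.

(** Distributivity: choosing a divisor of m is choosing one exponent for each
    variable. *)
Lemma sum_prod_submonos (F : comNzRingType) s m (H : nat -> nat -> F) : uniq s ->
  \sum_(p <- submonos s m) \prod_(i <- s) H i (p i) =
  \prod_(i <- s) \sum_(k <- iota 0 (m i).+1) H i k.
Proof.
elim: s => [|i s IH] us; first by rewrite !big_nil big_seq1 big_nil.
have /andP[si us'] := us.
rewrite submonos_cons big_allpairs_dep big_cons -IH // mulr_suml; apply: eq_bigr => k _.
rewrite mulr_sumr; apply: eq_bigr => p _.
rewrite big_cons fsfun_with; congr (_ * _); apply: eq_big_seq => j js.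
by rewrite fsfun_withE; case: eqP => // ji; rewrite -ji js in si.
Qed.

Definition divisors_of m := submonos (finsupp m) m.

Lemma divisors_ofP m p :
  reflect (forall i, p i <= m i)%N (p \in divisors_of m).
Proof.
apply: (iffP (submonosP _ _ (fset_uniq _))) => pm i; have := pm i; last first.
  by case: ifP => // /negbT/mono_notin ->.
by case: ifP => // _ /leq_trans; apply.
Qed.

Lemma divisors_of_uniq m : uniq (divisors_of m).
Proof. exact/submonos_uniq/fset_uniq. Qed.

Lemma mono_subK m p : p \in divisors_of m -> mono_add p (mono_sub m p) = m.
Proof.
by move/divisors_ofP => pm; apply/fsfunP => i; rewrite mono_addE mono_subE subnKC.
Qed.

Lemma mono_addK p q : mono_sub (mono_add p q) p = q.
Proof. by apply/fsfunP => i; rewrite mono_subE mono_addE addKn. Qed.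

Lemma divisors_of_add p q : p \in divisors_of (mono_add p q).
Proof. by apply/divisors_ofP => i; rewrite mono_addE leq_addr. Qed.

Definition mono_deg m := (\sum_(i <- finsupp m) m i)%N.

Lemma mono_degD p q : mono_deg (mono_add p q) = (mono_deg p + mono_deg q)%N.
Proof.
pose s : seq nat := (finsupp p `|` finsupp q)%fset.
have E r : {subset finsupp r <= s} -> mono_deg r = (\sum_(i <- s) r i)%N.
  move=> rs; rewrite /mono_deg.
  by rewrite /mono_deg -(@big_finsupp_widen _ _ _ s r (fun _ k => k)) // /s fset_uniq.
rewrite !E; first by rewrite -big_split; apply: eq_bigr => i _; rewrite mono_addE.
- by move=> i ip; rewrite in_fsetU ip orbT.
- by move=> i ip; rewrite in_fsetU ip.
- move=> i; rewrite mono_finsupp mono_addE in_fsetU !mono_finsupp.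
  by case: (p i).
Qed.

End Monomials.

Section SeriesAlgebra.
Variable R : realType.
Implicit Types (f g h : mps R) (m p q : monom).

(** A factorization of m is determined by its first factor, which turns the
    sum over pairs into a sum over a list of divisors. *)
Lemma mps_mulE f g m :
  mps_mul f g m = \sum_(p <- divisors_of m) f p * g (mono_sub m p).
Proof.
rewrite /mps_mul.
rewrite (_ : [set p | _]%classic =
    [set` [seq (p, mono_sub m p) | p <- divisors_of m]]%classic); last first.
  apply/seteqP; split=> [[p q] /= pq|[p q] /mapP[r rm [-> ->]] /= i].
    have -> : m = mono_add p q by apply/fsfunP => i; rewrite mono_addE pq.
    by apply/mapP; exists p; rewrite ?divisors_of_add ?mono_addK.
  by rewrite -mono_addE mono_subK.
rewrite -fsbig_seq; first by rewrite big_map.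
by rewrite map_inj_uniq ?divisors_of_uniq // => p q [].
Qed.

Lemma mps_mulC : commutative (@mps_mul R).
Proof.
move=> f g; apply/funext => m; rewrite !mps_mulE.
have inv p : p \in divisors_of m -> mono_sub m (mono_sub m p) = p.
  by move=> pm; rewrite -{1}(mono_subK pm) mono_addC mono_addK.
have div p : p \in divisors_of m -> mono_sub m p \in divisors_of m.
  by move=> pm; rewrite -{2}(mono_subK pm) mono_addC divisors_of_add.
rewrite (perm_big [seq mono_sub m p | p <- divisors_of m]) /=; last first.
  apply: uniq_perm; rewrite ?map_inj_in_uniq ?divisors_of_uniq //.
    by move=> p q pm qm pq; rewrite -(inv p pm) pq inv.
  move=> p; apply/idP/mapP => [pm|[q qm ->]]; last exact: div.
  by exists (mono_sub m p); rewrite ?inv ?div.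
rewrite big_map; apply: eq_big_seq => p pm; by rewrite inv // mulrC.
Qed.

(** Both sides are sums over the pairs of monomials whose product divides m,
    and swapping the two components preserves this condition. With
    commutativity it gives associativity at once. *)
Lemma mps_mulCA f g h : mps_mul f (mps_mul g h) = mps_mul g (mps_mul f h).
Proof.
apply/funext => m; rewrite !mps_mulE.
pose pairs := [seq (p, q) | p <- divisors_of m, q <- divisors_of (mono_sub m p)].
have pairsP p q : reflect (forall i, p i + q i <= m i)%N ((p, q) \in pairs).
  apply: (iffP idP) => [/allpairsPdep/= [p' [q' [pm qm [-> ->]]]] i|pq].
    have /divisors_ofP/(_ i) := qm; rewrite mono_subE.
    by have /divisors_ofP/(_ i) := pm; lia.
  apply/allpairsPdep; exists p, q; split=> //; apply/divisors_ofP => i; first by have := pq i; lia.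
  by rewrite mono_subE; have := pq i; lia.
have pairsU : uniq pairs.
  apply: allpairs_uniq_dep => [|p _|]; rewrite ?divisors_of_uniq //.
  by move=> [p q] [p' q'] _ _ /= [-> ->].
have E (u v w : mps R) : \sum_(p <- divisors_of m) u p * mps_mul v w (mono_sub m p) =
    \sum_(x <- pairs) u x.1 * v x.2 * w (mono_sub m (mono_add x.1 x.2)).
  rewrite /pairs big_allpairs_dep; apply: eq_bigr => p _.
  rewrite mps_mulE mulr_sumr; apply: eq_bigr => q _; rewrite mulrA /=.
  congr (_ * w _); apply/fsfunP => i.
  by rewrite !mono_subE mono_addE subnDA.
rewrite !E (perm_big [seq (x.2, x.1) | x <- pairs]) /=; last first.
  apply: uniq_perm => //.
    by rewrite map_inj_uniq // => -[p q] [p' q'] [-> ->].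
  move=> [p q]; apply/idP/mapP => [pq|[[a b] ab [-> ->]]].
    exists (q, p) => //; apply/pairsP => i; rewrite addnC; exact: pairsP.
  by apply/pairsP => i /=; rewrite addnC; exact: pairsP.
rewrite big_map; apply: eq_bigr => -[p q] _ /=.
by rewrite mono_addC; congr (_ * _); exact: mulrC.
Qed.

Lemma mps_mulA : associative (@mps_mul R).
Proof.
by move=> f g h; rewrite (mps_mulC g) mps_mulCA mps_mulC.
Qed.

Lemma mps_mul1 : left_id (@mps_one R) (@mps_mul R).
Proof.
move=> f; apply/funext => m; rewrite mps_mulE.
have m0 : mono0 \in divisors_of m by apply/divisors_ofP => i; rewrite mono0E.
rewrite (bigD1_seq mono0) ?divisors_of_uniq //= big1 => [|p p0].
  rewrite addr0 /mps_one finsupp_mono_eq0 eqxx mul1r; congr f.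
  by apply/fsfunP => i; rewrite mono_subE mono0E subn0.
by rewrite /mps_one finsupp_mono_eq0 (negPf p0) mul0r.
Qed.

HB.instance Definition _ :=
  Monoid.isComLaw.Build (mps R) (@mps_one R) (@mps_mul R) mps_mulA mps_mulC mps_mul1.

Lemma elem_sym_partE (la : intpart) :
  elem_sym_part R la = \big[@mps_mul R/@mps_one R]_(k <- la) elem_sym R k.
Proof. by rewrite /elem_sym_part unlock. Qed.

(** In the product with Q(x_i), where the other factor does not involve x_i,
    only the divisor of m carrying the whole exponent of x_i contributes. *)
Lemma mps_subst_prodE (a : nat -> R) s m : uniq s ->
  foldr (fun i f => mps_mul (mps_subst a i) f) (@mps_one R) s m =
  if all (fun j => j \in s) (finsupp m) then \prod_(i <- s) a (m i) else 0.
Proof.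
elim: s m => [|i s IH] m /=.
  move=> _; rewrite big_nil /mps_one; case: allP => ms; case: eqP => //= m0.
    by case: m0; apply/fsetP => j; rewrite inE; apply/negP => /ms.
  by case: ms => j; rewrite m0.
move=> /andP[si us]; rewrite mps_mulE.
pose p0 : monom := [fsfun mono0 with i |-> m i].
have p0E j : p0 j = if j == i then m i else 0%N.
  by rewrite fsfun_withE mono0E.
have p0m : p0 \in divisors_of m.
  by apply/divisors_ofP => j; rewrite p0E; case: eqP => // ->.
rewrite (bigD1_seq p0) ?divisors_of_uniq //= big_seq_cond big1 => [|p /andP[pm pp0]].
  rewrite addr0 IH // /mps_subst p0E eqxx ifT; last first.
    by apply/allP => j; rewrite mono_finsupp p0E; case: eqP.
  rewrite (_ : all _ (finsupp (mono_sub m p0)) =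
               all (fun j => j \in i :: s) (finsupp m)).
    case: ifP => _; last by rewrite mulr0.
    rewrite big_cons; congr (_ * _); apply: eq_big_seq => j js.
    rewrite mono_subE p0E; case: eqP => [ji|_]; last by rewrite subn0.
    by rewrite -ji js in si.
  apply/allP/allP => ms j jm.
    rewrite inE; case: (eqVneq j i) => //= ji; apply: ms.
    by rewrite mono_finsupp mono_subE p0E (negPf ji) subn0 -mono_finsupp.
  move: jm; rewrite mono_finsupp mono_subE p0E; case: (eqVneq j i) => [->|ji].
    by rewrite subnn.
  by rewrite subn0 -mono_finsupp => /ms; rewrite inE (negPf ji).
rewrite /mps_subst IH //; case: ifP => [/allP pi|_]; last by rewrite mul0r.
case: ifP => [/allP ms|_]; last by rewrite mulr0.
case/eqP: pp0; apply/fsfunP => j; rewrite p0E; case: eqP => [->|/eqP ji].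
  apply/eqP; rewrite eqn_leq (divisors_ofP _ _ pm) /= leqNgt -subn_gt0 -mono_subE.
  by rewrite -mono_finsupp; apply/negP => /ms; apply/negP.
by rewrite mono_notin //; apply: contra ji => /pi.
Qed.

Lemma mps_prodE (a : nat -> R) m : a 0%N = 1 ->
  mps_prod a m = \prod_(i <- finsupp m) a (m i).
Proof.
move=> a0; rewrite /mps_prod.
apply: (@cvg_lim R); first exact: Rhausdorff.
apply: cvg_near_cst; exists (\max_(i <- finsupp m) i).+1 => // N /= mN.
have sub : {subset finsupp m <= iota 0 N}.
  move=> i im; rewrite mem_iota /= add0n; apply: leq_ltn_trans mN.
  exact: (@leq_bigmax_seq _ (enum_fset (finsupp m)) xpredT id).
rewrite mps_subst_prodE ?iota_uniq // ifT; last by apply/allP.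
by rewrite (big_finsupp_widen _ (G := fun _ k => a k)) ?iota_uniq.
Qed.

End SeriesAlgebra.

(** * Integer partitions *)

Section IntegerPartitions.
Implicit Types (la mu : intpart) (s t : seq nat) (k d : nat).

Lemma intpart_sorted la : sorted geq la.
Proof. by case: la => s /= /andP[]. Qed.

Lemma intpart_gt0 la k : k \in parts la -> (0 < k)%N.
Proof. by case: la => s /= /andP[_ /allP]; apply. Qed.

Lemma intpart_perm_eq la mu : perm_eq la mu -> la = mu.
Proof.
move=> lamu; apply/val_inj/(@sorted_eq _ geq) => //; try exact: intpart_sorted.
- by move=> x y z yx xz; exact: leq_trans xz yx.
- by move=> x y /andP[yx xy]; apply/eqP; rewrite eqn_leq; apply/andP.
Qed.

Definition intpart0 : intpart := @IntPart [::] isT.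

Definition add_part k la : intpart := insubd intpart0 (sort geq (k :: la)).
Definition rem_part k la : intpart := insubd intpart0 (rem k la).

Lemma perm_add_part k la : (0 < k)%N -> perm_eq (add_part k la) (k :: la).
Proof.
move=> k0; rewrite /add_part val_insubd ifT ?perm_sort //.
apply/andP; split; first by apply: sort_sorted => x y; exact: leq_total.
by rewrite all_sort /= k0; apply/allP => i /intpart_gt0.
Qed.

Lemma val_rem_part k la : rem_part k la = rem k la :> seq nat.
Proof.
rewrite val_insubd ifT //; apply/andP; split.
  apply: (subseq_sorted _ (rem_subseq k la) (intpart_sorted la)).
  by move=> x y z yx xz; exact: leq_trans xz yx.
by apply/allP => i /mem_rem/intpart_gt0.
Qed.

Lemma add_partK k : (0 < k)%N -> cancel (add_part k) (rem_part k).
Proof.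
move=> k0 la; apply: intpart_perm_eq; rewrite val_rem_part.
have kin : k \in parts (add_part k la) by rewrite (perm_mem (perm_add_part la k0)) mem_head.
by rewrite -(perm_cons k) -(permPl (perm_to_rem kin)) perm_add_part.
Qed.

Lemma rem_partK k la : k \in parts la -> add_part k (rem_part k la) = la.
Proof.
move=> kla; apply: intpart_perm_eq.
apply: perm_trans (perm_add_part _ (intpart_gt0 kla)) _.
by rewrite val_rem_part perm_sym perm_to_rem.
Qed.

Lemma weight_add_part k la : (0 < k)%N -> weight (add_part k la) = (k + weight la)%N.
Proof.
by move=> k0; rewrite /weight (perm_sumn (perm_add_part la k0)).
Qed.

Fixpoint intparts_rec d : seq intpart :=
  if d is d'.+1 then
    intparts_rec d' ++ [seq add_part k la | k <- iota 1 d, la <- intparts_rec d']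
  else [:: intpart0].

(** Listing the partitions of bounded weight turns finitely supported sums
    over all partitions into ordinary sums. *)
Definition intparts_upto d : seq intpart :=
  [seq la <- undup (intparts_rec d) | (weight la <= d)%N].

Lemma intparts_upto_uniq d : uniq (intparts_upto d).
Proof. by rewrite filter_uniq // undup_uniq. Qed.

Lemma part_le_sumn s k : k \in s -> (k <= sumn s)%N.
Proof.
by elim: s => //= x s IH; rewrite inE => /orP[/eqP->|/IH]; lia.
Qed.

Lemma weight_eq0 la : weight la = 0%N -> la = intpart0.
Proof.
move=> w0; apply: val_inj => /=.
case E: (parts la) (@intpart_gt0 la) => [//|x s] /(_ x); rewrite mem_head => /(_ isT).
by move: w0; rewrite /weight E /=; lia.
Qed.

Lemma mem_intparts_upto d la : (la \in intparts_upto d) = (weight la <= d)%N.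
Proof.
rewrite mem_filter mem_undup andbC; case wd: (weight la <= d)%N; rewrite ?andbF // andbT.
elim: d la wd => [|d IH] la wd.
  by move: wd; rewrite leqn0 => /eqP/weight_eq0 ->; rewrite inE.
rewrite mem_cat; move: wd; rewrite leq_eqVlt => /orP[/eqP wd|wd]; last by rewrite IH.
have [k kla] : exists k, k \in parts la.
  by case: la wd => -[|k s] p //= _; exists k; rewrite mem_head.
apply/orP; right; apply/allpairsP; exists (k, rem_part k la); split => /=.
- by have := part_le_sumn kla; rewrite -/(weight la) wd (mem_iota 1 d.+1) (intpart_gt0 kla) add1n.
- apply: IH; have := weight_add_part (rem_part k la) (intpart_gt0 kla).
  by rewrite rem_partK // wd; have := intpart_gt0 kla; lia.
- by rewrite rem_partK.
Qed.

Definition seq_mult_fact s : nat := (\prod_(i <- undup s) (count_mem i s)`!)%N.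

Lemma seq_mult_fact_perm s t : perm_eq s t -> seq_mult_fact s = seq_mult_fact t.
Proof.
move=> st; rewrite /seq_mult_fact (perm_big _ (perm_undup (perm_mem st))) /=.
by apply: eq_bigr => i _; congr (_`!); exact: seq.permP.
Qed.

Lemma seq_mult_fact_cons k s :
  seq_mult_fact (k :: s) = ((count_mem k s).+1 * seq_mult_fact s)%N.
Proof.
rewrite /seq_mult_fact /=; case: ifP => ks.
  rewrite (bigD1_seq k) ?undup_uniq ?mem_undup //=.
  rewrite [in RHS](bigD1_seq k) ?undup_uniq ?mem_undup //= eqxx factS mulnA.
  by congr (_ * _)%N; apply: eq_bigr => i /negPf ik; rewrite eq_sym ik.
rewrite big_cons /= eqxx (count_memPn (negbT ks)) mul1n mul1n.
apply: eq_big_seq => i; rewrite mem_undup => is_.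
by case: eqP => [ki|] //; rewrite ki is_ in ks.
Qed.

End IntegerPartitions.

(** * Expansion of a product of values in elementary symmetric functions *)

Section InjectiveSumsOverSequences.
Variable F : comNzRingType.
Implicit Types (ys : seq F) (s t : seq nat).

(** The sums over injective maps indexed by a sequence of exponents, so that
    removing an element does not change the type of the index set. *)
Fixpoint inj_seq ys s : F :=
  if ys is y :: ys' then
    inj_seq ys' s + \sum_(k <- s) y ^+ k * inj_seq ys' (rem k s)
  else (s == [::])%:R.

Lemma inj_seq_perm ys s t : perm_eq s t -> inj_seq ys s = inj_seq ys t.
Proof.
elim: ys s t => [|y ys IH] s t st /=.
  by rewrite -!size_eq0 (perm_size st).
rewrite (IH s t) // (perm_big _ st) /=; congr (_ + _).
apply: eq_big_seq => k kt; congr (_ * _); apply: IH.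
have ks : k \in s by rewrite (perm_mem st).
rewrite -(perm_cons k) -(permPl (perm_to_rem ks)) -(permPr (perm_to_rem kt)).
exact: st.
Qed.

Lemma inj_sum_seq (T : finType) (la : T -> nat) ys (D : {set T}) :
  inj_sum la ys D = inj_seq ys [seq la i | i <- enum D].
Proof.
elim: ys D => [|y ys IH] D /=.
  by rewrite -size_eq0 size_map -cardE cards_eq0.
rewrite IH big_map big_enum /=; congr (_ + _).
apply: eq_bigr => z zD; congr (_ * _); rewrite IH; apply: inj_seq_perm.
have zDe : z \in enum D by rewrite mem_enum.
rewrite -(perm_cons (la z)) -(permPr (perm_to_rem (map_f la zDe))) -map_cons.
apply/perm_map/uniq_perm; rewrite ?enum_uniq //=.
  by rewrite enum_uniq mem_enum in_setD1 eqxx.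
by move=> u; rewrite inE !mem_enum in_setD1; case: eqP => // ->.
Qed.

End InjectiveSumsOverSequences.

Section ElementaryExpansion.
Variable R : realType.
Implicit Types (m p q : monom) (la mu : intpart) (c : seq nat).

Local Notation elem_prod c :=
  (\big[@mps_mul R/@mps_one R]_(k <- c) elem_sym R k).

(** The form in which support arguments on products are used: a nonzero
    coefficient comes from a divisor that is nonzero in both factors. *)
Lemma mps_mul_neq0 (f g : mps R) m : mps_mul f g m != 0 ->
  exists p, [/\ p \in divisors_of m, f p != 0 & g (mono_sub m p) != 0].
Proof.
move=> fg; apply: contrapT => nex; case/eqP: fg; rewrite mps_mulE.
rewrite big_seq big1 // => p pm; apply/eqP; rewrite mulf_eq0.
case: eqP => //= /eqP fp; case: eqP => //= /eqP gp.
by case: nex; exists p.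
Qed.

Lemma elem_sym_neq0 k m : elem_sym R k m != 0 ->
  (forall i, m i <= 1)%N /\ mono_deg m = k.
Proof.
rewrite /elem_sym pnatr_eq0 eqb0 negbK => /andP[/eqP sz /allP m1]; split=> [i|].
  by case: (finsuppP m i) => [|/m1/eqP->].
rewrite /mono_deg (eq_big_seq (fun=> 1%N)) => [|i /m1/eqP] //.
by rewrite sum1_size.
Qed.

Lemma elem_prod_neq0 c m : elem_prod c m != 0 ->
  (forall i, m i <= size c)%N /\ mono_deg m = sumn c.
Proof.
elim: c m => [|k c IH] m.
  rewrite big_nil /mps_one pnatr_eq0 eqb0 negbK => /eqP m0.
  split=> [i|]; last by rewrite /mono_deg m0 big_nil.
  by rewrite mono_notin // m0 inE.
rewrite big_cons => /mps_mul_neq0[p [pm /elem_sym_neq0[p1 pk] /IH[qc qs]]].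
rewrite -(mono_subK pm); split=> [i|]; last by rewrite mono_degD pk qs.
by rewrite mono_addE /=; have := p1 i; have := qc i; lia.
Qed.

Lemma elem_sym_part_eq0 la m : mono_deg m != weight la -> elem_sym_part R la m = 0.
Proof.
by move=> mla; apply: contraNeq mla; rewrite elem_sym_partE => /elem_prod_neq0[_ ->].
Qed.

Lemma elem_sym0 : elem_sym R 0 = @mps_one R.
Proof.
apply/funext => m; rewrite /elem_sym /mps_one cardfs_eq0.
by case: eqP => //= ->.
Qed.

Lemma elem_sym_part_add k la : (0 < k)%N ->
  mps_mul (elem_sym R k) (elem_sym_part R la) = elem_sym_part R (add_part k la).
Proof.
by move=> k0; rewrite !elem_sym_partE (perm_big _ (perm_add_part la k0)) big_cons.
Qed.

Variables (F : fieldType) (iota : {rmorphism R -> F}).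
Implicit Types ys : seq F.

(** The coefficient of x^m in the product of all the 1 + x_i y_j. *)
Definition prod_elem_val ys m : F := \prod_(i <- finsupp m) elem_val ys (m i).

(** The series e_k is the sum of the squarefree monomials of degree k;
    weighting it by y^k and summing over k makes the coefficient
    multiplicative over the variables. *)
Lemma sum_elem_sym (y : F) d p m : p \in divisors_of m -> (mono_deg p <= d)%N ->
  \sum_(k < d.+1) y ^+ k * iota (elem_sym R k p) =
  \prod_(i <- finsupp m) (if p i is j.+1 then (if j is 0 then y else 0) else 1).
Proof.
move=> pm pd.
rewrite (@big_finsupp_widen _ _ _ _ p
  (fun _ k => if k is j.+1 then (if j is 0 then y else 0) else 1)) ?fset_uniq //; last first.
  move=> i; rewrite !mono_finsupp => /leq_trans; apply; exact: divisors_ofP.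
have [/allP p1|/allPn[i ip pi]] := boolP (all (fun i => p i == 1%N) (finsupp p)).
  have pdE : mono_deg p = #|` finsupp p|.
    by rewrite /mono_deg (eq_big_seq (fun=> 1%N)) ?sum1_size // => i /p1/eqP.
  have -> : \prod_(i <- finsupp p) (if p i is j.+1 then if j is 0 then y else 0 else 1)
      = \prod_(i <- finsupp p) y.
    by apply: eq_big_seq => i /p1/eqP ->.
  rewrite big_const_seq count_predT iter_mulr_1 -[size _]/(#|` finsupp p|) -pdE.
  rewrite (bigD1 (inord (mono_deg p))) //= inordK ?ltnS // big1 ?addr0.
    by rewrite /elem_sym -pdE eqxx (introT allP p1) rmorph1 mulr1.
  move=> k /eqP kp; rewrite /elem_sym -pdE; case: eqP => /= [pk|]; last by rewrite rmorph0 mulr0.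
  by case: kp; apply: val_inj => /=; rewrite inordK ?ltnS.
rewrite big1 => [|k _]; last first.
  rewrite /elem_sym; case: allP => [p1|_]; last by rewrite andbF rmorph0 mulr0.
  by rewrite (p1 i) in pi.
rewrite (bigD1_seq i) ?fset_uniq //=; move: ip; rewrite mono_finsupp.
by case: (p i) pi => [|[|k]] // _ _; rewrite mul0r.
Qed.

(** Adjoining y multiplies the product of the 1 + x_i y_j by the product of
    the 1 + x_i y, which is the sum of the y^k e_k. *)
Lemma prod_elem_val_cons y ys d m : (mono_deg m <= d)%N ->
  prod_elem_val (y :: ys) m =
  \sum_(k < d.+1) y ^+ k * \sum_(p <- divisors_of m)
     iota (elem_sym R k p) * prod_elem_val ys (mono_sub m p).
Proof.
move=> md; pose G (k : nat) : F := if k is j.+1 then (if j is 0 then y else 0) else 1.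
transitivity (\sum_(p <- divisors_of m)
    \prod_(i <- finsupp m) (G (p i) * elem_val ys (m i - p i))).
  rewrite (sum_prod_submonos m (fun i k => G k * elem_val ys (m i - k))) ?fset_uniq //.
  apply: eq_big_seq => i; rewrite mono_finsupp; case: (m i) => // k _.
  rewrite -[k.+2]addn2 addnC iotaD big_cat /= !big_cons !big_nil /= subn0 subn1 /=.
  rewrite mul1r addr0 big_seq big1 ?addr0 // => -[|[|j]]; rewrite mem_iota //=.
  by rewrite mul0r.
under [RHS]eq_bigr do rewrite mulr_sumr.
rewrite exchange_big /=; apply: eq_big_seq => p pm.
have pd : (mono_deg p <= d)%N.
  by apply: leq_trans md; rewrite -(mono_subK pm) mono_degD leq_addr.
under [RHS]eq_bigr do rewrite mulrA.
rewrite -mulr_suml (sum_elem_sym _ pm pd) big_split /=; congr (_ * _).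
rewrite /prod_elem_val -(@big_finsupp_widen _ _ _ (finsupp m) _ (fun _ k => elem_val ys k)).
- by apply: eq_bigr => i _; rewrite mono_subE.
- exact: fset_uniq.
- by move=> i; rewrite !mono_finsupp mono_subE subn_gt0 => /(leq_ltn_trans (leq0n _)).
- by move=> _; rewrite elem_val0.
Qed.

(** The value at ys of the monomial symmetric function of s: each of its terms
    arises from as many injective maps as there are permutations of equal
    parts. *)
Definition mono_val ys (s : seq nat) : F := inj_seq ys s / (seq_mult_fact s)%:R.

(** Equal parts contribute the same term to inj_seq, and a part k of
    multiplicity r is counted r times while r! is r times the factorial (r -
    1)! of the remaining multiplicity. *)
Lemma mono_val_cons y ys s :
  mono_val (y :: ys) s =
  mono_val ys s + \sum_(k <- undup s) y ^+ k * mono_val ys (rem k s).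
Proof.
rewrite /mono_val /= mulrDl; congr (_ + _).
rewrite -big_undup_iterop_count /= mulr_suml; apply: eq_big_seq => k.
rewrite mem_undup => ks.
rewrite Monoid.iteropE.
have natF n : (0 < n)%N -> n%:R != 0 :> F.
  by move=> n0; rewrite -(rmorph_nat iota) fmorph_eq0 pnatr_eq0 -lt0n.
have mf0 : (0 < seq_mult_fact (rem k s))%N by apply: prodn_gt0 => i; exact: fact_gt0.
rewrite (seq_mult_fact_perm (perm_to_rem ks)) seq_mult_fact_cons.
have -> : count_mem k s = (count_mem k (rem k s)).+1.
  by rewrite ((seq.permP (perm_to_rem ks)) _) /= eqxx.
rewrite [iter _ _ _]iter_addr_0 natrM invfM -[X in X * _ = _]mulr_natl.
set n := (count_mem k (rem k s)).+1.
by rewrite mulrACA mulfV ?natF // mul1r mulrA.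
Qed.

(** Multiplying by y^k e_k adds a part k to the partition, so collecting the
    terms in e_mu amounts to removing one part of mu, which is the recursion
    of mono_val_cons. *)
Lemma prod_elem_val_expansion ys d m : (mono_deg m <= d)%N ->
  prod_elem_val ys m =
  \sum_(la <- intparts_upto d) mono_val ys la * iota (elem_sym_part R la m).
Proof.
elim: ys m => [|y ys IH] m md.
  have i0 : intpart0 \in intparts_upto d by rewrite mem_intparts_upto.
  rewrite (bigD1_seq intpart0) ?intparts_upto_uniq //= big1 ?addr0 => [|la la0].
    rewrite /mono_val /= /seq_mult_fact big_nil divr1 mul1r elem_sym_partE big_nil.
    rewrite /mps_one /prod_elem_val; case: eqP => [->|/eqP/fset0Pn[i im]].
      by rewrite big_nil rmorph1.
    rewrite rmorph0 (bigD1_seq i) ?fset_uniq //=.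
    by move: im; rewrite mono_finsupp; case: (m i) => // k _; rewrite mul0r.
  rewrite /mono_val /=; case: eqP => [la1|]; last by rewrite !mul0r.
  by case/eqP: la0; exact: val_inj.
rewrite (prod_elem_val_cons y ys md).
transitivity (\sum_(k < d.+1) \sum_(la <- intparts_upto d)
   y ^+ k * mono_val ys la * iota (mps_mul (elem_sym R k) (elem_sym_part R la) m)).
  apply: eq_bigr => k _.
  transitivity (y ^+ k * \sum_(p <- divisors_of m) \sum_(la <- intparts_upto d)
     iota (elem_sym R k p) * (mono_val ys la * iota (elem_sym_part R la (mono_sub m p)))).
    congr (_ * _); apply: eq_big_seq => p pm; rewrite IH ?mulr_sumr //.
    by apply: leq_trans md; rewrite -[in X in (_ <= X)%N](mono_subK pm) mono_degD leq_addl.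
  rewrite exchange_big mulr_sumr /=; apply: eq_bigr => la _.
  rewrite mps_mulE rmorph_sum !mulr_sumr; apply: eq_bigr => p _.
  by rewrite rmorphM (mulrCA (iota (elem_sym R k p))) -[RHS]mulrA.
rewrite big_ord_recl /= elem_sym0.
under [in X in X + _]eq_bigr do rewrite mps_mul1 expr0 mul1r.
under [RHS]eq_bigr do rewrite mono_val_cons mulrDl.
rewrite big_split /=; congr (_ + _).
transitivity (\sum_(i < d) \sum_(mu <- intparts_upto d | i.+1 \in parts mu)
    y ^+ i.+1 * mono_val ys (rem i.+1 mu) * iota (elem_sym_part R mu m)).
  apply: eq_bigr => i _; rewrite /bump /= add1n; set k := i.+1.
  (* Partitions whose weight leaves the range after adding k have weight
     larger than the degree of m and do not contribute. *)
  rewrite (bigID (fun la => weight la + k <= d)%N) /= [X in _ + X]big1 ?addr0; last first.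
    move=> la; rewrite -ltnNge elem_sym_part_add // => ldk.
    rewrite elem_sym_part_eq0 ?rmorph0 ?mulr0 // weight_add_part //.
    by rewrite addnC neq_ltn (leq_ltn_trans md ldk).
  rewrite -big_filter -[RHS]big_filter.
  (* For fixed k, adding the part k is a bijection onto the partitions of
     weight at most d that have a part k. *)
  rewrite [RHS](perm_big [seq add_part k la |
      la <- [seq la <- intparts_upto d | (weight la + k <= d)%N]]) /=.
    rewrite big_map; apply: eq_bigr => la _; rewrite elem_sym_part_add //.
    by rewrite -val_rem_part add_partK.
  apply: uniq_perm.
  - by rewrite filter_uniq // intparts_upto_uniq.
  - rewrite map_inj_uniq ?(filter_uniq _ (intparts_upto_uniq d)) //.
    exact: (can_inj (@add_partK k (ltn0Sn i))).
  move=> mu; rewrite mem_filter mem_intparts_upto.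
  apply/andP/mapP => [[kmu mud]|[la]].
    exists (rem_part k mu); last by rewrite rem_partK.
    rewrite mem_filter mem_intparts_upto.
    by have := weight_add_part (rem_part k mu) (ltn0Sn i); rewrite rem_partK //; lia.
  rewrite mem_filter mem_intparts_upto => /andP[lk _] ->.
  rewrite weight_add_part // addnC lk; split => //.
  by rewrite (perm_mem (perm_add_part la (ltn0Sn i))) mem_head.
rewrite (exchange_big_dep xpredT) //=; apply: eq_big_seq => mu; rewrite mem_intparts_upto => mud.
rewrite -mulr_suml; congr (_ * _).
rewrite -(big_mkord (fun i => i.+1 \in parts mu) (fun i => y ^+ i.+1 * mono_val ys (rem i.+1 mu))).
rewrite -(big_map S (fun k => k \in parts mu) (fun k => y ^+ k * mono_val ys (rem k mu))).
rewrite -big_filter; apply: perm_big; apply: uniq_perm; rewrite ?undup_uniq //.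
  by rewrite filter_uniq // map_inj_uniq ?iota_uniq // => i j [].
move=> k; rewrite mem_filter mem_undup; case kmu: (k \in parts mu) => //=.
apply/mapP; exists k.-1; last by rewrite prednK // (intpart_gt0 kmu).
rewrite mem_index_iota /=; have := part_le_sumn kmu; have := intpart_gt0 kmu.
by move: mud; rewrite /weight; lia.
Qed.

End ElementaryExpansion.

(** * Existence and uniqueness of the coefficients of a genus *)

Lemma enum_part (la : intpart) : [seq part i | i <- enum 'I_(plength la)] = la.
Proof.
rewrite -[RHS](mkseq_nth 0%N) /mkseq -/(plength la) -val_enum_ord -map_comp.
exact: eq_map.
Qed.

Lemma block_sum_le_weight (la : intpart) (B : {set 'I_(plength la)}) :
  (block_sum B <= weight la)%N.
Proof.
rewrite /block_sum /weight -[in X in (_ <= X)%N](enum_part la) sumnE big_map big_enum /=.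
by rewrite [leqRHS](bigID (mem B)) /= leq_addr.
Qed.

Lemma part_gt0 (la : intpart) (j : 'I_(plength la)) : (0 < part j)%N.
Proof. by apply: (@intpart_gt0 la); rewrite /part mem_nth. Qed.

Lemma block_sum_gt0 (la : intpart) (B : {set 'I_(plength la)}) j :
  j \in B -> (0 < block_sum B)%N.
Proof.
by move=> jB; rewrite /block_sum (bigD1 j) //=; have := part_gt0 j; lia.
Qed.

Section MoebiusCoefficients.
Variable R : realType.
Implicit Types (a c : nat -> R) (la mu : intpart) (m : monom).

Definition moebius_sum c la : R :=
  partition_sum (fun B : {set 'I_(plength la)} =>
      (-1) ^+ #|B|.-1 * (#|B|.-1)`!%:R * c (block_sum B)) (finset.setTfor _).

Definition moebius_coef c la : R := ((mult_fact la)%:R)^-1 * moebius_sum c la.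

(** Every block sum lies between 1 and the weight, so only power sums in that
    range matter; the result is the image of an expression over R. *)
Lemma inj_seq_moebius (F : comNzRingType) (iota : {rmorphism R -> F})
    (ys : seq F) c la :
  (forall k, (k < weight la)%N -> power_sum ys k.+1 = iota (c k.+1)) ->
  inj_seq ys la = iota (moebius_sum c la).
Proof.
move=> yc.
transitivity (inj_seq ys [seq part i | i <- enum (finset.setTfor 'I_(plength la))]).
  by rewrite enum_setT -enumT enum_part.
rewrite -inj_sum_seq inj_sum_partition.
rewrite /moebius_sum /partition_sum rmorph_sum; apply: eq_bigr => P partP.
rewrite rmorph_prod; apply: eq_bigr => B BP.
rewrite !rmorphM rmorphXn rmorphN1 rmorph_nat -/(block_sum B).
have [j jB] : exists j, j \in B.
  exact/finset.set0Pn/(partition_neq0 partP BP).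
have := block_sum_gt0 jB; have := block_sum_le_weight B.
by case: (block_sum B) => // b bw _; rewrite yc.
Qed.

(** Newton's identities with a in the role of the elementary symmetric
    functions and c in the role of the power sums. *)
Definition newton_related a c : Prop :=
  a 0%N = 1 /\ forall k, k.+1%:R * a k.+1 =
     \sum_(i < k.+1) (-1) ^+ i * c i.+1 * a (k - i)%N.

(** The numbers ys exist only in an algebraically closed extension, but both
    sides of the expansion that they give are images of elements of R. *)
Lemma mps_prod_moebius a c d m : newton_related a c -> (mono_deg m <= d)%N ->
  mps_prod a m =
  \sum_(la <- intparts_upto d) moebius_coef c la * elem_sym_part R la m.
Proof.
move=> [a0 ac] md; pose iota : {rmorphism R -> R[i]} := @real_complex R.
have ia0 : (iota \o a) 0%N = 1 by rewrite /= a0 rmorph1.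
have [ys ysa] := @exists_elem_val R[i] (iota \o a) d ia0.
have yc k : (k < d)%N -> power_sum ys k.+1 = iota (c k.+1).
  move=> kd; apply: (newton_power_sum (c := iota \o c) ysa) kd.
  move=> n /=; rewrite -(rmorph_nat iota) -rmorphM ac rmorph_sum.
  by apply: eq_bigr => i _; rewrite !rmorphM rmorphXn rmorphN1.
apply: (fmorph_inj iota); rewrite mps_prodE // rmorph_prod rmorph_sum /=.
transitivity (prod_elem_val ys m).
  apply: eq_big_seq => i im; rewrite ysa //; apply: leq_trans md.
  by rewrite /mono_deg (bigD1_seq i) ?fset_uniq //= leq_addr.
rewrite (prod_elem_val_expansion iota _ md); apply: eq_big_seq => la.
rewrite mem_intparts_upto => lad.
rewrite rmorphM /mono_val (@inj_seq_moebius _ iota _ c) => [|k kla]; last first.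
  by apply: yc; exact: leq_trans kla lad.
by rewrite /moebius_coef rmorphM fmorphV rmorph_nat mulrC [_ / _]mulrC mulrC.
Qed.

Lemma fsbig_intparts (f : intpart -> R) d :
  (forall la, (d < weight la)%N -> f la = 0) ->
  \sum_(la \in [set la | (1 <= weight la)%N]%classic) f la =
  \sum_(la <- intparts_upto d | (1 <= weight la)%N) f la.
Proof.
move=> f0; rewrite -[RHS]big_filter [RHS]fsbig_seq; last first.
  by rewrite filter_uniq // intparts_upto_uniq.
symmetry; apply: fsbig_widen => [la /=|la [/= la1]].
  by rewrite mem_filter => /andP[].
rewrite mem_filter la1 mem_intparts_upto /= => /negP; rewrite -ltnNge.
exact: f0.
Qed.

Lemma mult_fact_weight0 la : weight la = 0%N -> mult_fact la = 1%N.
Proof. by move/weight_eq0 ->; rewrite /mult_fact big_nil. Qed.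

Lemma moebius_coef0 c : moebius_coef c intpart0 = 1.
Proof.
rewrite /moebius_coef mult_fact_weight0 // invr1 mul1r /moebius_sum.
rewrite (_ : finset.setTfor _ = finset.set0) ?partition_sum0 //.
by apply/finset.setP => -[].
Qed.

Lemma genus_expansion_moebius a c : newton_related a c ->
  genus_expansion a (moebius_coef c).
Proof.
move=> ac; split=> [la /weight_eq0 ->|m]; first exact: moebius_coef0.
rewrite (fsbig_intparts (d := mono_deg m)); last first.
  by move=> la mla; rewrite elem_sym_part_eq0 ?mulr0 // neq_ltn mla.
rewrite (mps_prod_moebius ac (leqnn _)) (bigID (fun la => 1 <= weight la)%N) /= addrC.
congr (_ + _); rewrite -big_filter.
rewrite (perm_big [:: intpart0]) /=.
  by rewrite big_seq1 moebius_coef0 mul1r elem_sym_partE big_nil.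
apply: uniq_perm; rewrite ?(filter_uniq _ (intparts_upto_uniq _)) // => la.
rewrite mem_filter mem_intparts_upto inE -leqNgt leqn0.
by apply/andP/eqP => [[/eqP/weight_eq0]|->].
Qed.

End MoebiusCoefficients.

Section Uniqueness.
Variable R : realType.
Implicit Types (la mu nu : intpart) (m p q : monom) (s t : seq nat) (k d : nat).

Local Notation elem_prod c :=
  (\big[@mps_mul R/@mps_one R]_(k <- c) elem_sym R k).

(** For series with nonnegative coefficients no cancellation can hide a given
    factorization of the monomial. *)
Lemma mps_mul_ge (f g : mps R) p q : (forall m, 0 <= f m) -> (forall m, 0 <= g m) ->
  f p * g q <= mps_mul f g (mono_add p q).
Proof.
move=> f0 g0; rewrite mps_mulE (bigD1_seq p) ?divisors_of_uniq ?divisors_of_add //=.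
by rewrite mono_addK lerDl sumr_ge0 // => r _; rewrite mulr_ge0.
Qed.

Lemma elem_sym_ge0 k m : 0 <= elem_sym R k m.
Proof. exact: ler0n. Qed.

Lemma elem_prod_ge0 s m : 0 <= elem_prod s m.
Proof.
elim: s m => [|k s IH] m; first by rewrite big_nil ler0n.
rewrite big_cons mps_mulE; apply: sumr_ge0 => p _.
by rewrite mulr_ge0 // elem_sym_ge0.
Qed.

Definition initial_mono k : monom := [fsfun i in seq_fset tt (iota 0 k) => 1%N].

Lemma initial_monoE k i : initial_mono k i = (i < k)%N.
Proof. by rewrite fsfunE seq_fsetE mem_iota /= add0n; case: ltnP. Qed.

(** Its exponents are the parts of the conjugate partition. The coefficient of
    e_la on it is positive, and e_mu vanishes on it unless mu is dominated by
    la; it therefore isolates the coefficient of e_la. *)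
Definition conj_mono s : monom := foldr (fun k => mono_add (initial_mono k)) mono0 s.

Lemma conj_monoE s i : conj_mono s i = count (fun k => i < k)%N s.
Proof.
by elim: s => [|k s IH] /=; rewrite ?mono0E // mono_addE initial_monoE IH.
Qed.

Lemma elem_sym_initial k : elem_sym R k (initial_mono k) = 1.
Proof.
have sz : #|` finsupp (initial_mono k)| = k.
  rewrite (_ : finsupp _ = seq_fset tt (iota 0 k)); last first.
    apply/fsetP => i; rewrite mono_finsupp initial_monoE seq_fsetE mem_iota add0n.
    by case: (i < k)%N.
  by rewrite size_seq_fset undup_id ?iota_uniq // size_iota.
rewrite /elem_sym sz eqxx (introT allP) // => i.
by rewrite mono_finsupp initial_monoE; case: (i < k)%N.
Qed.

Lemma elem_prod_conj_gt0 s : 0 < elem_prod s (conj_mono s).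
Proof.
elim: s => [|k s IH]; first by rewrite big_nil /mps_one finsupp0 eqxx.
rewrite big_cons; apply: lt_le_trans (mps_mul_ge _ _ (elem_sym_ge0 k) (elem_prod_ge0 s)).
by rewrite elem_sym_initial mul1r.
Qed.

(** The first k factors contribute a divisor of m whose exponents are at most
    k, and its degree is the sum of the first k parts. *)
Lemma elem_prod_dominance s m k : elem_prod s m != 0 ->
  (sumn (take k s) <= \sum_(i <- finsupp m) minn k (m i))%N.
Proof.
rewrite -{1}(cat_take_drop k s) big_cat => /mps_mul_neq0[p [pm pt _]].
have [p1 <-] := elem_prod_neq0 pt.
rewrite /mono_deg -(@big_finsupp_widen _ _ _ (finsupp m) p (fun _ k => k)) ?fset_uniq //; last first.
  by move=> i; rewrite !mono_finsupp => /leq_trans; apply; exact: divisors_ofP.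
apply: leq_sum => i _; rewrite leq_min (divisors_ofP _ _ pm) andbT.
by apply: leq_trans (p1 i) _; rewrite size_take_min geq_minl.
Qed.

(** In a nonincreasing sequence the entries larger than i come first. *)
Lemma minn_count_take s k i : sorted geq s ->
  (minn k (count (fun x => i < x)%N s) <= count (fun x => i < x)%N (take k s))%N.
Proof.
elim: s k => [|x s IH] [|k] //=; rewrite ?minn0 ?min0n // => xs.
have [ix|xi] := ltnP i x; first by rewrite !add1n minnSS ltnS IH // (path_sorted xs).
rewrite (_ : count _ s = 0%N) ?minn0 //.
apply/eqP; rewrite -leqn0 leqNgt -has_count -all_predC; apply/allP => y ys /=.
have /allP/(_ y ys) : all (geq x) s.
  by apply: order_path_min xs => u v w vu uw; exact: leq_trans uw vu.
by rewrite /= -leqNgt => /leq_trans; apply.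
Qed.

Lemma sum_count_le (r : seq nat) s : uniq r ->
  (\sum_(i <- r) count (fun x => i < x)%N s <= sumn s)%N.
Proof.
move=> ur; elim: s => [|x s IH] /=; first by rewrite big1.
rewrite big_split leq_add //= -big_mkcond sum1_count -size_filter.
rewrite -[x in (_ <= x)%N](size_iota 0) uniq_leq_size ?filter_uniq // => i.
by rewrite mem_filter mem_iota => /andP[].
Qed.

Lemma conj_dominance la mu k : elem_sym_part R mu (conj_mono la) != 0 ->
  (sumn (take k mu) <= sumn (take k la))%N.
Proof.
rewrite elem_sym_partE => /(elem_prod_dominance k)/leq_trans; apply.
apply: leq_trans (sum_count_le (take k la) (fset_uniq (finsupp (conj_mono la)))).
apply: leq_sum => i _; rewrite conj_monoE; apply: minn_count_take.
exact: intpart_sorted.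
Qed.

(** A strictly monotone numerical function for the dominance order, on which
    induction can be done. *)
Definition dominance_rank d s := (\sum_(k < d.+1) sumn (take k s))%N.

Lemma size_le_weight la : (size la <= weight la)%N.
Proof.
rewrite /weight; elim: (parts la) (@intpart_gt0 la) => //= x s IH pos.
have posS k : k \in s -> (0 < k)%N by move=> ks; apply: pos; rewrite inE ks orbT.
by have := pos x (mem_head _ _); have := IH posS; lia.
Qed.

Lemma nth_sumn_take s k : (sumn (take k s) + nth 0 s k = sumn (take k.+1 s))%N.
Proof.
have [ks|sk] := ltnP k (size s); first by rewrite (take_nth 0%N) // sumn_rcons.
by rewrite nth_default // addn0 !take_oversize // leqW.
Qed.

Lemma eq_intpart_take la mu d : (weight la <= d)%N -> (weight mu <= d)%N ->
  (forall k, (k <= d)%N -> sumn (take k la) = sumn (take k mu)) -> la = mu.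
Proof.
move=> lad mud E; have nthE k : nth 0%N la k = nth 0%N mu k.
  have [kd|dk] := ltnP k d.
    apply: (@addnI (sumn (take k la))).
    by rewrite nth_sumn_take E // [in RHS]E ?nth_sumn_take // ltnW.
  by rewrite !nth_default // (leq_trans (size_le_weight _)) // (leq_trans _ dk).
have sz la' mu' : (forall k, nth 0%N la' k = nth 0%N mu' k) -> (size la' <= size mu')%N.
  move=> E'; rewrite leqNgt; apply/negP => lt.
  have := @intpart_gt0 la' _ (mem_nth 0%N lt).
  by rewrite E' nth_default.
apply/val_inj/(@eq_from_nth _ 0%N) => [|k _]; last exact: nthE.
by apply/eqP; rewrite eqn_leq !sz.
Qed.

Lemma dominance_rank_lt la mu d : (weight la <= d)%N -> (weight mu <= d)%N ->
  (forall k, sumn (take k mu) <= sumn (take k la))%N -> mu != la ->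
  (dominance_rank d mu < dominance_rank d la)%N.
Proof.
move=> lad mud dom; apply: contraNltn => rk.
apply/eqP/(eq_intpart_take mud lad) => k; rewrite -ltnS => kd.
apply/eqP; rewrite eqn_leq dom /= leqNgt; apply/negP => lt.
move: rk; rewrite leqNgt => /negP; apply.
rewrite /dominance_rank (bigD1 (Ordinal kd)) // [ltnRHS](bigD1 (Ordinal kd)) //=.
by rewrite -addSn leq_add // leq_sum.
Qed.

(** Induction along dominance: at the monomial conj_mono la, all the terms of
    the two expansions agree by induction except the one of la, whose e_la has
    a nonzero coefficient. *)
Lemma genus_expansion_inj (a : nat -> R) (b b' : intpart -> R) :
  genus_expansion a b -> genus_expansion a b' -> b = b'.
Proof.
move=> [b0 bE] [b'0 b'E]; apply/funext => la.
have [la0|] := posnP (weight la); first by rewrite b0 // b'0.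
move Ed : (weight la) => d d0.
have [n] := ubnP (dominance_rank d la); elim: n la Ed => // n IH la Ed; rewrite ltnS => rk.
have w f : \sum_(mu \in [set la | (1 <= weight la)%N]%classic)
     f mu * elem_sym_part R mu (conj_mono la) =
   \sum_(mu <- intparts_upto d | (1 <= weight mu)%N)
     f mu * elem_sym_part R mu (conj_mono la).
  apply: fsbig_intparts => mu; rewrite -Ed => lamu.
  rewrite elem_sym_part_eq0 ?mulr0 //.
  have := elem_prod_conj_gt0 la => /lt0r_neq0/elem_prod_neq0[_ ->].
  by rewrite -/(weight la) neq_ltn lamu.
have := bE (conj_mono la); rewrite b'E => /addrI; rewrite !w.
have lain : la \in intparts_upto d by rewrite mem_intparts_upto Ed.
have la1 : (1 <= weight la)%N by rewrite Ed.
move/esym/eqP; rewrite -subr_eq0 -sumrB -big_filter (bigD1_seq la) /=; first last.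
- by rewrite filter_uniq // intparts_upto_uniq.
- by rewrite mem_filter la1.
rewrite big_seq_cond big1 => [|mu /andP[]].
  rewrite addr0 -mulrBl mulf_eq0 elem_sym_partE (gt_eqF (elem_prod_conj_gt0 la)) orbF.
  by rewrite subr_eq0 => /eqP.
rewrite mem_filter mem_intparts_upto => /andP[mu1 mud] mula.
have [->|e0] := eqVneq (elem_sym_part R mu (conj_mono la)) 0.
  by rewrite !mulr0 subrr.
have muw : weight mu = d.
  have := e0; rewrite elem_sym_partE => /elem_prod_neq0[_].
  have := elem_prod_conj_gt0 la => /lt0r_neq0/elem_prod_neq0[_ ->].
  by rewrite -/(weight la) Ed.
rewrite IH ?subrr //; apply: leq_trans rk.
by apply: dominance_rank_lt => //; [rewrite Ed|move=> k; exact: conj_dominance].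
Qed.

End Uniqueness.

(** * Zeta values and the Euler constant *)

Local Open Scope classical_set_scope.
Local Open Scope ring_scope.

Section ZetaValues.
Variable R : realType.
Implicit Types (N k : nat) (x : R).

(** The zeta values are the limits of the power sums of 1/N, ..., 1/2, 1. The
    largest index comes first, as in the definition of multiple zeta values.
    *)
Fixpoint inverses N : seq R :=
  if N is N'.+1 then N%:R^-1 :: inverses N' else [::].

Local Notation harmonic_sum k := (fun N => power_sum (inverses N) k).

Lemma power_sumS N k :
  power_sum (inverses N.+1) k = N.+1%:R^-1 ^+ k + power_sum (inverses N) k.
Proof. by rewrite /power_sum big_cons. Qed.

Lemma inverses_bounds N y : y \in inverses N -> 0 < y <= 1.
Proof.
elim: N => //= N IH; rewrite inE => /orP[/eqP->|//].
by rewrite invr_gt0 ltr0Sn invf_le1 ?ltr0Sn // ler1n.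
Qed.

Lemma power_sum_ge0 N k : 0 <= power_sum (inverses N) k.
Proof.
elim: N => [|N IH]; first by rewrite /power_sum big_nil.
by rewrite power_sumS addr_ge0 // exprn_ge0 // invr_ge0.
Qed.

Lemma harmonic_sum_nd k : nondecreasing_seq (harmonic_sum k).
Proof.
apply/nondecreasing_seqP => N.
by rewrite power_sumS lerDr exprn_ge0 // invr_ge0.
Qed.

(** Telescoping: 1/(n+1)^2 is at most 1/n - 1/(n+1). *)
Lemma power_sum2_le N : power_sum (inverses N.+1) 2 <= 2 - N.+1%:R^-1.
Proof.
elim: N => [|N IH]; first by rewrite power_sumS /power_sum big_nil invr1; lra.
rewrite power_sumS; apply: le_trans (lerD (lexx _) IH) _.
have a0 : (0 : R) < N.+1%:R by rewrite ltr0Sn.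
rewrite -(natr1 N.+1); move: (N.+1%:R : R) a0 => a a0.
rewrite -subr_ge0 (_ : _ - _ = (a * (a + 1) ^+ 2)^-1); last by field; rewrite !gt_eqF //; lra.
by rewrite invr_ge0; apply: mulr_ge0; [exact: ltW|exact: sqr_ge0].
Qed.

Lemma power_sum_le_2 N k : (2 <= k)%N ->
  power_sum (inverses N) k <= power_sum (inverses N) 2.
Proof.
move=> k2; elim: N => [|N IH]; first by rewrite /power_sum !big_nil.
rewrite !power_sumS lerD // ler_wiXn2l // ?invr_ge0 // invf_le1 ?ltr0Sn //.
by rewrite ler1n.
Qed.

Lemma power_sum_ub N k : (2 <= k)%N -> power_sum (inverses N) k <= 2.
Proof.
move=> k2; apply: le_trans (power_sum_le_2 N k2) _.
case: N => [|N]; first by rewrite /power_sum big_nil.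
by apply: le_trans (power_sum2_le N) _; rewrite gerBl invr_ge0.
Qed.

Lemma zeta_seriesE k :
  series (fun n => n.+1%:R `^ (- (k%:R : R))) = harmonic_sum k.
Proof.
apply/funext => N; rewrite /series /=; elim: N => [|N IH].
  by rewrite big_geq // /power_sum big_nil.
rewrite big_nat_recr //= IH power_sumS addrC; congr (_ + _).
by rewrite powRN powR_mulrn ?exprVn.
Qed.

Lemma cvg_zeta k : (2 <= k)%N -> harmonic_sum k @ \oo --> zeta (k%:R : R).
Proof.
move=> k2; rewrite /zeta zeta_seriesE.
apply: nondecreasing_is_cvgn; first exact: harmonic_sum_nd.
by exists 2 => _ [N _ <-]; exact: power_sum_ub.
Qed.

Lemma power_sum_le_zeta N k : (2 <= k)%N ->
  power_sum (inverses N) k <= zeta (k%:R : R).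
Proof.
move=> k2; rewrite -(cvg_lim (@Rhausdorff R) (cvg_zeta k2)).
apply: (nondecreasing_cvgn_le (@harmonic_sum_nd k)).
by apply/cvg_ex; eexists; exact: cvg_zeta.
Qed.

Lemma zeta_gt1 k : (2 <= k)%N -> 1 < zeta (k%:R : R).
Proof.
move=> k2; apply: lt_le_trans (power_sum_le_zeta 2 k2).
rewrite !power_sumS /power_sum big_nil addr0 invr1 expr1n ltrDr.
by rewrite exprn_gt0 // invr_gt0.
Qed.

Lemma zeta_le2 k : (2 <= k)%N -> zeta (k%:R : R) <= 2.
Proof.
move=> k2; rewrite -(cvg_lim (@Rhausdorff R) (cvg_zeta k2)).
apply: limr_le; first by apply/cvg_ex; eexists; exact: cvg_zeta.
by apply: nearW => N; exact: power_sum_ub.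
Qed.

Lemma zeta_tail_le N k : (2 <= k)%N ->
  zeta (k%:R : R) - power_sum (inverses N) k <=
  zeta (2%:R : R) - power_sum (inverses N) 2.
Proof.
move=> k2; rewrite lerBrDr -addrA addrC -lerBrDr addrC.
have D : (fun M => power_sum (inverses M) 2 - power_sum (inverses M) k) @ \oo
    --> zeta (2%:R : R) - zeta (k%:R : R).
  by apply: cvgB; exact: cvg_zeta.
rewrite -(cvg_lim (@Rhausdorff R) D).
apply: (nondecreasing_cvgn_le _ (cvgP _ D)).
apply/nondecreasing_seqP => M; rewrite !power_sumS.
rewrite opprD addrACA lerDr subr_ge0 ler_wiXn2l // ?invr_ge0 // invf_le1 ?ltr0Sn //.
by rewrite ler1n.
Qed.

Lemma ln_step N : N.+2%:R^-1 <= ln (N.+2%:R : R) - ln N.+1%:R <= N.+1%:R^-1.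
Proof.
have a0 : (0 : R) < N.+1%:R by rewrite ltr0Sn.
rewrite -(natr1 N.+1); move: (N.+1%:R : R) a0 => a a0.
have b0 : 0 < a + 1 by lra.
rewrite -ln_div ?posrE //; apply/andP; split.
  rewrite -[leRHS]opprK lerNr -lnV ?posrE ?divr_gt0 // invf_div.
  rewrite (_ : a / (a + 1) = 1 + - (a + 1)^-1); last by field; rewrite gt_eqF.
  by apply: le_ln1Dx; rewrite ltrN2 invf_lt1 //; lra.
rewrite (_ : (a + 1) / a = 1 + a^-1); last by field; rewrite gt_eqF.
by apply: le_ln1Dx; rewrite (@lt_trans _ _ 0) ?invr_gt0 //; lra.
Qed.

(** From the index 1 on, where its value is 1, the defining sequence is
    nonincreasing and nonnegative, hence convergent with limit at most 1. *)
Lemma euler_gamma_le1 : euler_gamma R <= 1.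
Proof.
pose u n : R := \sum_(1 <= i < n.+1) (i%:R)^-1 - ln n%:R.
have uS n : u n.+2 <= u n.+1.
  rewrite /u big_nat_recr //= -addrA lerD2l.
  by have /andP[lo _] := ln_step n; rewrite lerBlDr addrC.
have u1 n : u n.+1 <= 1.
  elim: n => [|n IH]; last exact: le_trans (uS n) IH.
  by rewrite /u big_nat1 ln1 invr1; lra.
have u0 n : ln n.+1%:R <= \sum_(1 <= i < n.+1) (i%:R : R)^-1.
  elim: n => [|n IH]; first by rewrite big_geq // ln1.
  have /andP[_] := ln_step n; rewrite lerBlDl => hi.
  by rewrite big_nat_recr //=; apply: le_trans hi _; rewrite lerD2r.
have cu : cvgn (fun n => u n.+1).
  apply: nonincreasing_is_cvgn; first by apply/nonincreasing_seqP => n; exact: uS.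
  exists 0 => _ [n _ <-]; rewrite /u subr_ge0.
  rewrite big_nat_recr //=; apply: le_trans (u0 n) _.
  by rewrite lerDl invr_ge0.
have -> : euler_gamma R = limn (fun n => u n.+1).
  rewrite /euler_gamma -/u; apply: (cvg_lim (@Rhausdorff R)).
  by rewrite -(@cvg_shiftS R u).
by apply: limr_le => //; apply: nearW => n; exact: u1.
Qed.

End ZetaValues.

(** * Taylor coefficients from a logarithmic derivative *)

Section LogarithmicDerivative.
Variable R : realType.
Implicit Types (f : R -> R) (B : nat -> R -> R) (n : nat) (r x : R).

Lemma near_ball0 r x : `|x| < r -> \forall y \near x, `|y| < r.
Proof.
move=> xr; exists (r - `|x|) => /=; first by rewrite subr_gt0.
move=> y /=; rewrite ltrBrDr distrC => yx.
by apply: le_lt_trans yx; rewrite -{1}(subrK x y) ler_normD.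
Qed.

(** The function B i stands for the i-th derivative of the logarithmic
    derivative B 0 of f, divided by i!. With A n the n-th derivative of f
    divided by n!, the claim is (n+1) A (n+1) = sum of the B i A (n-i).
    Differentiating the right-hand side multiplies the term B i A (n+1-i) by i
    + (n+1-i) = n+1, which gives the next case. *)
Lemma derive1n_factorial_cauchy f B r :
  (forall x, `|x| < r -> is_derive x 1 f (B 0%N x * f x)) ->
  (forall i x, `|x| < r -> is_derive x 1 (B i) (i.+1%:R * B i.+1 x)) ->
  forall n x, `|x| < r ->
    is_derive x 1 (derive1n n f) (derive1n (n.+1) f x) /\
    derive1n (n.+1) f x / n`!%:R =
      \sum_(i < n.+1) B i x * (derive1n (n - i) f x / (n - i)`!%:R).
Proof.
move=> f' B'; have factn0 n : n`!%:R != 0 :> R by rewrite pnatr_eq0 -lt0n fact_gt0.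
elim/ltn_ind => -[|n] IH x xr.
  rewrite derive1n0 derive1n1; have fx := f' x xr.
  have E : derive1 f x = B 0%N x * f x by rewrite derive1E derive_val.
  by split; rewrite ?big_ord1 /= E // subnn fact0 mulrA.
have IHn i (y : R) : (i <= n)%N -> `|y| < r ->
    is_derive y 1 (derive1n i f) (derive1n (i.+1) f y)
  by move=> iln yr; apply: (IH i _ y yr).1.
pose A i y := derive1n i f y / i`!%:R.
pose S y := n`!%:R * \sum_(i < n.+1) B i y * A (n - i)%N y.
have SE : \forall y \near x, S y = derive1n n.+1 f y.
  apply: filterS (near_ball0 xr) => y yr.
  by rewrite /S -(IH n _ y yr).2 // mulrCA divff ?mulr1.
pose dS := n`!%:R * \sum_(i < n.+1)
   (B i x * ((n - i).+1%:R * A (n - i).+1 x) + i.+1%:R * B i.+1 x * A (n - i)%N x).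
have S' : is_derive x 1 S dS.
  rewrite (_ : S = n`!%:R \*: \sum_(i < n.+1)
      (B i * ((n - i)`!%:R^-1 \*: derive1n (n - i) f))); last first.
    apply/funext => y; rewrite /S; congr (_ * _); rewrite fct_sumE.
    by apply: eq_bigr => i _; congr (_ * _); rewrite /A mulrC.
  apply: is_deriveZ; apply: is_derive_sum => i.
  have BAi := is_deriveM (B' i x xr)
     (is_deriveZ (n - i)`!%:R^-1 (IHn (n - i)%N x (leq_subr _ _) xr)).
  apply: is_derive_eq BAi _; congr (_ + _).
    congr (_ * _); rewrite /A factS natrM invfM mulrCA mulVKf ?pnatr_eq0 //.
    exact: mulrC.
  by rewrite /A -[LHS]/(_ * _ * _) mulrC (mulrC _^-1).
have fn : is_derive x 1 (derive1n n.+1 f) dS by apply: near_eq_is_derive SE S'.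
have fE : derive1n n.+2 f x = dS by rewrite derive1nS derive1E derive_val.
split; first by rewrite fE.
have -> : derive1n n.+2 f x / (n.+1)`!%:R =
    n.+1%:R^-1 * \sum_(i < n.+1) (B i x * ((n - i).+1%:R * A (n - i).+1 x)
                          + i.+1%:R * B i.+1 x * A (n - i)%N x).
  by rewrite fE /dS factS natrM invfM [LHS]mulrC -mulrA mulKf.
apply: (@mulfI _ n.+1%:R); first by rewrite pnatr_eq0.
rewrite mulrA divff ?pnatr_eq0 // mul1r big_split /= mulr_sumr.
have -> : \sum_(i < n.+1) B i x * ((n - i).+1%:R * A (n - i).+1 x) =
          \sum_(i < n.+2) (n.+1 - i)%:R * (B i x * A (n.+1 - i)%N x).
  rewrite [RHS]big_ord_recr /= subnn mul0r addr0; apply: eq_bigr => i _.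
  by rewrite subSn 1?mulrCA // -ltnS.
have -> : \sum_(i < n.+1) i.+1%:R * B i.+1 x * A (n - i)%N x =
          \sum_(i < n.+2) i%:R * (B i x * A (n.+1 - i)%N x).
  rewrite [RHS]big_ord_recl /= mul0r add0r; apply: eq_bigr => i _.
  by rewrite /bump /= add1n subSS mulrA.
rewrite -big_split; apply: eq_bigr => i _ /=.
by rewrite -mulrDl -natrD subnK // -ltnS.
Qed.

Lemma taylor_coef_log_derive f B r : 0 < r ->
  (forall x, `|x| < r -> is_derive x 1 f (B 0%N x * f x)) ->
  (forall i x, `|x| < r -> is_derive x 1 (B i) (i.+1%:R * B i.+1 x)) ->
  forall n, n.+1%:R * taylor_coef f n.+1 =
    \sum_(i < n.+1) B i 0 * taylor_coef f (n - i).
Proof.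
move=> r0 f' B' n; have r0' : `|0 : R| < r by rewrite normr0.
rewrite /taylor_coef -(derive1n_factorial_cauchy f' B' n r0').2.
by rewrite factS natrM invfM mulrCA mulVKf ?pnatr_eq0.
Qed.

End LogarithmicDerivative.

(** * Power series on the unit disc *)

Section UnitDiscSeries.
Variable R : realType.
Implicit Types (c : nat -> R) (x q : R).

Definition unit_disc_cvg c : Prop := forall x, `|x| < 1 -> cvgn (pseries c x).

Lemma unit_disc_cvg_bounded c M : (forall k, `|c k| <= M) -> unit_disc_cvg c.
Proof.
move=> cM x x1; apply: normed_cvg.
have M0 : 0 <= M by apply: le_trans (cM 0%N); exact: normr_ge0.
apply: (@series_le_cvg _ _ (geometric M `|x|)) => [n|n|n|].
- exact: normr_ge0.
- by rewrite /geometric /= mulr_ge0 // exprn_ge0.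
- by rewrite /geometric /= normrM normrX ler_wpM2r // exprn_ge0.
- by apply: is_cvg_geometric_series; rewrite normr_id.
Qed.

(** The partial sums are increasing, and multiplied by (1 - q)^2 they
    telescope to 1 - q^n (1 + n (1 - q)). *)
Lemma is_cvg_arith_geometric q : 0 <= q < 1 ->
  cvgn (series (fun k => k.+1%:R * q ^+ k)).
Proof.
move=> /andP[q0 q1]; apply: nondecreasing_is_cvgn.
  by apply: nondecreasing_series => k _ _; rewrite mulr_ge0 // exprn_ge0.
exists ((1 - q) ^- 2) => _ [n _ <-].
have p0 : 0 < (1 - q) ^+ 2 by rewrite exprn_gt0 //; lra.
rewrite -(ler_pM2l p0) divff ?gt_eqF //.
suff -> : (1 - q) ^+ 2 * series (fun k => k.+1%:R * q ^+ k) n =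
    1 - q ^+ n * (1 + n%:R * (1 - q)).
  rewrite gerBl mulr_ge0 ?exprn_ge0 // addr_ge0 // mulr_ge0 //; lra.
elim: n => [|n IH]; first by rewrite /series /= big_geq // expr0; ring.
rewrite seriesSr mulrDr IH (exprS q) -natr1 /=; ring.
Qed.

(** Between |x| and 1 there is a point s at which the terms of the series are
    bounded; at x the differentiated terms are then dominated by those of an
    arithmetic-geometric series of ratio |x| / s. *)
Lemma unit_disc_cvg_diffs c : unit_disc_cvg c -> unit_disc_cvg (pseries_diffs c).
Proof.
move=> cc x x1; pose s := (1 + `|x|) / 2.
have x0 : 0 <= `|x| by [].
have s0 : 0 < s by rewrite /s; lra.
have s1 : s < 1 by rewrite /s; lra.
have xs : `|x| < s by rewrite /s; lra.
have /cvg_series_cvg_0 cs : cvgn (pseries c s) by apply: cc; rewrite gtr0_norm.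
have [M M0 cM] : exists2 M, 0 < M & forall k, `|c k * s ^+ k| <= M.
  have /cvg_seq_bounded/pinfty_ex_gt0[M M0 cM] : cvgn (fun k => c k * s ^+ k).
    by apply/cvg_ex; exists 0.
  by exists M => // k; apply: cM.
apply: normed_cvg; pose q := `|x| / s.
have q01 : 0 <= q < 1.
  by rewrite /q divr_ge0 ?(ltW s0) //= ltr_pdivrMr // mul1r.
apply: (@series_le_cvg _ _ (M / s *: (fun k => k.+1%:R * q ^+ k))) => [n|n|n|].
- exact: normr_ge0.
- by rewrite /= mulr_ge0 ?divr_ge0 ?(ltW M0) ?(ltW s0) // mulr_ge0 // exprn_ge0; case/andP: q01.
- rewrite /= /pseries_diffs !normrM normr_nat normrX -[leRHS]/(M / s * (n.+1%:R * q ^+ n)).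
  rewrite [leRHS]mulrCA -[leLHS]mulrA.
  rewrite ler_wpM2l // /q expr_div_n.
  rewrite (_ : M / s * _ = M * (s ^+ n.+1)^-1 * `|x| ^+ n); last first.
    by rewrite exprS; field; rewrite ?expf_neq0 ?gt_eqF.
  rewrite ler_wpM2r ?exprn_ge0 // ler_pdivlMr ?exprn_gt0 //.
  by have := cM n.+1; rewrite normrM normrX (gtr0_norm s0).
- by apply: is_cvg_seriesZ; exact: is_cvg_arith_geometric.
Qed.

Lemma unit_disc_cvg_iter_diffs c i : unit_disc_cvg c ->
  unit_disc_cvg (iter i (@pseries_diffs R) c).
Proof. by move=> cc; elim: i => //= i; exact: unit_disc_cvg_diffs. Qed.

Lemma is_derive_pseries c x : unit_disc_cvg c -> `|x| < 1 ->
  is_derive x 1 (fun y => limn (pseries c y)) (limn (pseries (pseries_diffs c) x)).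
Proof.
move=> cc x1; pose s := (1 + `|x|) / 2.
have x0 : 0 <= `|x| by [].
have s0 : 0 < s by rewrite /s; lra.
have s1 : `|s| < 1 by rewrite (gtr0_norm s0) /s; lra.
have xs : `|x| < `|s| by rewrite (gtr0_norm s0) /s; lra.
apply: (@pseries_snd_diffs _ c s) => //; first exact: cc.
  exact: unit_disc_cvg_diffs.
by apply: unit_disc_cvg_diffs => //; exact: unit_disc_cvg_diffs.
Qed.

Lemma limn_pseries0 c : limn (pseries c 0) = c 0%N.
Proof.
apply: (cvg_lim (@Rhausdorff R)).
rewrite -(@cvg_shiftS R); apply: cvg_near_cst; apply: nearW => n.
rewrite /pseries /series /= big_nat_recl // expr0 mulr1 big1 ?addr0 // => i _.
by rewrite expr0n mulr0.
Qed.

Lemma iter_pseries_diffs c i k :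
  k`!%:R * iter i (@pseries_diffs R) c k = (i + k)`!%:R * c (i + k)%N.
Proof.
elim: i k => [|i IH] k //=.
by rewrite {1}/pseries_diffs mulrA -natrM mulnC -factS IH addnS.
Qed.

(** The i-th derivative of the sum of the series, divided by i!. *)
Definition pseries_jet c i x : R := limn (pseries (iter i (@pseries_diffs R) c) x) / i`!%:R.

Lemma is_derive_pseries_jet c i x : unit_disc_cvg c -> `|x| < 1 ->
  is_derive x 1 (pseries_jet c i) (i.+1%:R * pseries_jet c i.+1 x).
Proof.
move=> cc x1.
rewrite (_ : pseries_jet c i = i`!%:R^-1 \*:
  (fun y => limn (pseries (iter i (@pseries_diffs R) c) y))); last first.
  by apply/funext => y; rewrite /pseries_jet mulrC.
apply: is_derive_eq.
  apply: is_deriveZ; apply: is_derive_pseries x1; exact: unit_disc_cvg_iter_diffs.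
rewrite -[LHS]/(_ * _) /pseries_jet factS natrM invfM [RHS]mulrCA mulVKf ?pnatr_eq0 //.
exact: mulrC.
Qed.

Lemma pseries_jet0 c i : pseries_jet c i 0 = c i.
Proof.
rewrite /pseries_jet limn_pseries0.
have := iter_pseries_diffs c i 0; rewrite fact0 mul1r addn0 => ->.
by rewrite mulrC mulKf // pnatr_eq0 -lt0n fact_gt0.
Qed.

End UnitDiscSeries.

(** * The power series of the Gamma genus *)

Section GammaSeries.
Variable R : realType.
Implicit Types (N k : nat) (x y : R) (ys : seq R).

(** The coefficients of the logarithmic derivative of 1 / Gamma(1 + x). *)
Definition log_derive_coef k : R := (-1) ^+ k * zetac R k.+1.
(** The coefficients of the logarithm of 1 / Gamma(1 + x). *)
Definition log_coef k : R := if k is j.+1 then log_derive_coef j / j.+1%:R else 0.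

Local Notation g := (fun x : R => limn (pseries log_coef x)).
Local Notation h := (fun x : R => limn (pseries log_derive_coef x)).

Lemma zetac_norm_le k : `|zetac R k.+1| <= `|euler_gamma R| + 2.
Proof.
rewrite /zetac; case: eqP => [_|k1]; first by rewrite lerDl.
have k2 : (2 <= k.+1)%N by case: k k1.
rewrite ger0_norm ?(le_trans _ (ltW (zeta_gt1 R k2))) //.
by apply: le_trans (zeta_le2 R k2) _; rewrite lerDr.
Qed.

Lemma log_derive_coef_cvg : unit_disc_cvg log_derive_coef.
Proof.
apply: (@unit_disc_cvg_bounded _ _ (`|euler_gamma R| + 2)) => k.
by rewrite /log_derive_coef normrM normrX normrN1 expr1n mul1r zetac_norm_le.
Qed.

Lemma log_coef_cvg : unit_disc_cvg log_coef.
Proof.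
apply: (@unit_disc_cvg_bounded _ _ (`|euler_gamma R| + 2)) => -[|k] /=.
  by rewrite normr0 addr_ge0.
rewrite normrM normfV normr_nat ler_pdivrMr ?ltr0Sn //.
rewrite /log_derive_coef normrM normrX normrN1 expr1n mul1r.
apply: le_trans (zetac_norm_le k) _.
by rewrite ler_peMr ?addr_ge0 // ler1n.
Qed.

Lemma log_coef_diffs : pseries_diffs log_coef = log_derive_coef.
Proof.
by apply/funext => k; rewrite /pseries_diffs /= mulrC divfK // pnatr_eq0.
Qed.

(** Geometric expansion of y / (1 + x y). *)
Lemma cvg_power_sum_series ys x : (forall y, y \in ys -> 0 < y <= 1) -> `|x| < 1 ->
  (fun K => \sum_(0 <= k < K) (-1) ^+ k * power_sum ys k.+1 * x ^+ k) @ \oo -->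
  \sum_(y <- ys) y / (1 + x * y).
Proof.
move=> ys01 x1; elim: ys ys01 => [|y ys IH] ys01.
  rewrite big_nil; apply: cvg_near_cst; apply: nearW => K.
  by rewrite big1 // => k _; rewrite /power_sum big_nil mulr0 mul0r.
have IH' := IH (fun z zys => ys01 z (@mem_behead _ (y :: ys) z zys)).
have /andP[y0 y1] := ys01 y (mem_head _ _).
have xy1 : `|- (x * y)| < 1.
  rewrite normrN normrM (gtr0_norm y0); apply: le_lt_trans x1.
  by rewrite ler_piMr.
have geo := @cvg_geometric_series _ y _ xy1.
rewrite opprK in geo; rewrite big_cons.
rewrite (_ : (fun K => _) = series (geometric y (- (x * y))) \+
   (fun K => \sum_(0 <= k < K) (-1) ^+ k * power_sum ys k.+1 * x ^+ k)); last first.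
  apply/funext => K; rewrite /series /= -big_split; apply: eq_bigr => k _ /=.
  rewrite /power_sum big_cons mulrDr mulrDl; congr (_ + _).
  by rewrite (exprNn (x * y)) exprMn exprS; ring.
exact: cvgD.
Qed.

(** The logarithm of a partial Weierstrass product, for ys the list of the
    1/i. *)
Definition log_partial_product ys x : R := \sum_(y <- ys) (ln (1 + x * y) - x * y).

Lemma one_plus_gt0 x y : 0 < y <= 1 -> `|x| < 1 -> 0 < 1 + x * y.
Proof.
move=> /andP[y0 y1] x1; have : `|x * y| < 1.
  by rewrite normrM (gtr0_norm y0); apply: le_lt_trans x1; rewrite ler_piMr.
by rewrite ltr_norml => /andP[+ _]; lra.
Qed.

Lemma is_derive_log_partial_product ys x :
  (forall y, y \in ys -> 0 < y <= 1) -> `|x| < 1 ->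
  is_derive x 1 (log_partial_product ys)
    (\sum_(y <- ys) y / (1 + x * y) - power_sum ys 1).
Proof.
move=> ys01 x1; elim: ys ys01 => [|y ys IH] ys01.
  rewrite /power_sum !big_nil subrr (_ : log_partial_product _ = cst 0).
    exact: is_derive_cst.
  by apply/funext => z; rewrite /log_partial_product big_nil.
have {}IH := IH (fun z zys => ys01 z (@mem_behead _ (y :: ys) z zys)).
have y01 := ys01 y (mem_head _ _).
have xy0 := one_plus_gt0 y01 x1.
rewrite (_ : log_partial_product _ =
   ((@ln R) \o (fun z => 1 + z * y)) - (fun z => z * y) + log_partial_product ys); last first.
  by apply/funext => z; rewrite /log_partial_product big_cons.
have lin : is_derive x 1 (fun z : R => z * y) y.
  rewrite (_ : (fun z => _) = y \*: id); last by apply/funext => z /=; rewrite mulrC.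
  by have := is_deriveZ y (is_derive_id x (1 : R)); rewrite -[_ *: _]/(_ * _) mulr1.
have aff : is_derive x 1 (fun z : R => 1 + z * y) y.
  rewrite (_ : (fun z => _) = cst 1 + (fun z => z * y)) //.
  by apply: is_derive_eq; rewrite add0r.
have lnd := @is_derive1_comp R (@ln R) (fun z => 1 + z * y) x _ _ (is_derive1_ln xy0) aff.
apply: is_derive_eq.
rewrite /power_sum !big_cons expr1.
by rewrite (mulrC y) opprD addrACA.
Qed.

Lemma expR_log_partial_product N x : `|x| < 1 ->
  \prod_(1 <= i < N.+1) ((1 + x / i%:R) * expR (- (x / i%:R))) =
  expR (log_partial_product (inverses R N) x).
Proof.
move=> x1; elim: N => [|N IH].
  by rewrite big_geq // /log_partial_product big_nil expR0.
rewrite big_nat_recr //= IH /log_partial_product big_cons expRD mulrC; congr (_ * _).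
rewrite expRD lnK // posrE one_plus_gt0 //.
by apply: (@inverses_bounds _ N.+1); rewrite inE eqxx.
Qed.

(** The difference between the logarithm of the N-th partial product and its
    expected limit. *)
Definition log_error N x : R :=
  euler_gamma R * x + log_partial_product (inverses R N) x - g x.

Definition zeta_tail N : R := zeta (2%:R : R) - power_sum (inverses R N) 2.

Lemma zeta_tail_ge0 N : 0 <= zeta_tail N.
Proof. by rewrite subr_ge0 power_sum_le_zeta. Qed.

(** Both logarithmic derivatives are power series, with k-th coefficients a
    truncated and a full zeta value. Their constant terms agree, the k-th
    coefficients differ by at most zeta_tail N, and the sum of |x|^k over k >=
    1 is at most 1 for |x| < 1/2. *)
Lemma log_error_derive_bound N x : `|x| < 2^-1 ->
  `|euler_gamma R + (\sum_(y <- inverses R N) y / (1 + x * y)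
        - power_sum (inverses R N) 1) - h x| <= zeta_tail N.
Proof.
move=> x2; have x1 : `|x| < 1 by lra.
set ys := inverses R N.
pose u K := euler_gamma R + (\sum_(0 <= k < K) (-1) ^+ k * power_sum ys k.+1 * x ^+ k
   - power_sum ys 1) - pseries log_derive_coef x K.
have uc : u @ \oo --> euler_gamma R + (\sum_(y <- inverses R N) y / (1 + x * y)
        - power_sum (inverses R N) 1) - h x.
  apply: cvgB; last exact: log_derive_coef_cvg.
  apply: cvgD; first exact: cvg_cst.
  apply: cvgB; last exact: cvg_cst.
  by apply: cvg_power_sum_series => // y; exact: inverses_bounds.
apply: (@ler_cvg_to _ \oo _ _ (fun K => `|u K.+1|) (cst (zeta_tail N))).
- apply: cvg_norm; rewrite (@cvg_shiftS R u); exact: uc.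
- exact: cvg_cst.
apply: nearW => K.
have -> : u K.+1 = \sum_(0 <= k < K)
    (-1) ^+ k.+1 * x ^+ k.+1 * (power_sum ys k.+2 - zeta k.+2%:R).
  rewrite /u /pseries /series /= !big_nat_recl // /log_derive_coef /zetac eqxx !expr0.
  set a := \sum_(0 <= k < K) _; set b := \sum_(0 <= k < K) _.
  (* The terms of index 0, both sums of the y and both gamma, cancel. *)
  transitivity (a - b); first by ring.
  rewrite /a /b -sumrB; apply: eq_bigr => k _; rewrite /=; ring.
apply: le_trans (ler_norm_sum _ _ _) _.
apply: (@le_trans _ _ (\sum_(0 <= k < K) (2^-1) ^+ k.+1 * zeta_tail N)).
  apply: ler_sum => k _; rewrite !normrM !normrX normrN1 expr1n mul1r.
  apply: ler_pM; rewrite ?exprn_ge0 //.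
    by apply: lerXn2r; rewrite ?nnegrE ?invr_ge0 // ltW.
  rewrite distrC ger0_norm ?subr_ge0 ?power_sum_le_zeta //.
  exact: zeta_tail_le.
rewrite -mulr_suml ler_piMl ?zeta_tail_ge0 //.
have -> : \sum_(0 <= k < K) (2^-1 : R) ^+ k.+1 = 1 - 2^-1 ^+ K.
  elim: (K) => [|n IH]; first by rewrite big_geq // expr0 subrr.
  rewrite big_nat_recr //= IH !exprS; move: (2^-1 ^+ n) => a; lra.
by rewrite gerBl exprn_ge0 // invr_ge0.
Qed.

Lemma is_derive_log_error N x : `|x| < 1 ->
  is_derive x 1 (log_error N)
    (euler_gamma R + (\sum_(y <- inverses R N) y / (1 + x * y)
        - power_sum (inverses R N) 1) - h x).
Proof.
move=> x1.
have dg : is_derive x 1 g (h x).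
  by rewrite -log_coef_diffs; exact: is_derive_pseries log_coef_cvg x1.
have dL := is_derive_log_partial_product (@inverses_bounds R N) x1.
rewrite (_ : log_error N = euler_gamma R \*: id + log_partial_product (inverses R N) - g) //.
by apply: is_derive_eq; rewrite -[_ *: _]/(_ * _) mulr1.
Qed.

Lemma log_error0 N : log_error N 0 = 0.
Proof.
rewrite /log_error limn_pseries0 mulr0 add0r subr0 /log_partial_product.
by rewrite big1 // => y _; rewrite mul0r addr0 ln1 subrr.
Qed.

(** Mean value theorem between 0 and x, the error being 0 at 0. *)
Lemma log_error_bound N x : `|x| < 2^-1 -> `|log_error N x| <= zeta_tail N.
Proof.
move=> x2.
pose d z := euler_gamma R + (\sum_(y <- inverses R N) y / (1 + z * y)
        - power_sum (inverses R N) 1) - h z.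
have D (z : R) : `|z| < 2^-1 -> is_derive z 1 (log_error N) (d z).
  by move=> z2; apply: is_derive_log_error; lra.
have bnd z : `|z| < 2^-1 -> `|d z| * `|x| <= zeta_tail N.
  move=> z2; apply: le_trans (log_error_derive_bound N z2).
  by rewrite ler_piMr //; lra.
have cont a b : (forall z, a <= z <= b -> `|z| < 2^-1) ->
    {within `[a, b], continuous (log_error N)}.
  move=> ab; apply: derivable_within_continuous => z; rewrite in_itv /= => zab.
  by have [] := D z (ab z zab).
have x2' := x2; rewrite ltr_norml in x2'; have /andP[xl xr] := x2'.
have [x0|x0|->] := ltgtP x 0; last by rewrite log_error0 normr0 zeta_tail_ge0.
- have ab z : x <= z <= 0 -> `|z| < 2^-1.
    by move=> /andP[xz z0]; rewrite ltr_norml; apply/andP; split; lra.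
  have [||c] := @MVT R (log_error N) d x 0 x0.
  + by move=> z; rewrite in_itv /= => /andP[xz z0]; apply/D/ab; rewrite !ltW.
  + exact: cont.
  rewrite in_itv /= log_error0 !sub0r => /andP[xc c0] E.
  have c2 : `|c| < 2^-1 by apply: ab; rewrite !ltW.
  by rewrite -normrN E normrM normrN; exact: bnd.
- have ab z : 0 <= z <= x -> `|z| < 2^-1.
    by move=> /andP[z0 zx]; rewrite ltr_norml; apply/andP; split; lra.
  have [||c] := @MVT R (log_error N) d 0 x x0.
  + by move=> z; rewrite in_itv /= => /andP[xz z0]; apply/D/ab; rewrite !ltW.
  + exact: cont.
  rewrite in_itv /= log_error0 !subr0 => /andP[c0 cx] E.
  have c2 : `|c| < 2^-1 by apply: ab; rewrite !ltW.
  by rewrite E normrM; exact: bnd.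
Qed.

Lemma cvg_log_partial_product x : `|x| < 2^-1 ->
  (fun N => log_partial_product (inverses R N) x) @ \oo --> g x - euler_gamma R * x.
Proof.
move=> x2.
have tail0 : zeta_tail @ \oo --> (0 : R).
  rewrite -[X in _ --> X](subrr (zeta (2%:R : R))); apply: cvgB; first exact: cvg_cst.
  exact: cvg_zeta.
have err0 : (fun N => log_error N x) @ \oo --> (0 : R).
  apply: (@squeeze_cvgr _ _ _ _ (fun N => - zeta_tail N) zeta_tail) => //.
    by apply: nearW => N; rewrite -ler_norml log_error_bound.
  by rewrite -oppr0; exact: cvgN.
rewrite (_ : (fun N => _) = (fun N => log_error N x + (g x - euler_gamma R * x))).
  by rewrite -[X in _ --> X]add0r; apply: cvgD => //; exact: cvg_cst.
by apply/funext => N; rewrite /log_error; ring.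
Qed.

Lemma inv_Gamma1_expR x : `|x| < 2^-1 -> inv_Gamma1 x = expR (g x).
Proof.
move=> x2; rewrite /inv_Gamma1.
have x1 : `|x| < 1 by lra.
have -> : (fun N => \prod_(1 <= i < N.+1) ((1 + x / i%:R) * expR (- (x / i%:R)))) =
    (fun N => expR (log_partial_product (inverses R N) x)).
  by apply/funext => N; exact: expR_log_partial_product.
rewrite (cvg_lim (@Rhausdorff R) (_ : _ @ \oo --> expR (g x - euler_gamma R * x))).
  by rewrite -expRD; congr expR; ring.
apply: continuous_cvg; [exact: continuous_expR|exact: cvg_log_partial_product].
Qed.

Lemma is_derive_inv_Gamma1 x : `|x| < 2^-1 ->
  is_derive x 1 (@inv_Gamma1 R) (h x * inv_Gamma1 x).
Proof.
move=> x2; have x1 : `|x| < 1 by lra.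
have dg : is_derive x 1 g (h x).
  by rewrite -log_coef_diffs; exact: is_derive_pseries log_coef_cvg x1.
have de := is_derive1_comp (is_derive_expR (g x)) dg.
rewrite inv_Gamma1_expR // mulrC; apply: near_eq_is_derive de.
by apply: filterS (near_ball0 x2) => y y2; rewrite inv_Gamma1_expR.
Qed.

(** Near 0 the function 1 / Gamma(1 + x) has the logarithmic derivative gamma
    - zeta(2) x + zeta(3) x^2 - ..., and the recursion that this gives for
    Taylor coefficients has the form of Newton's identities. *)
Lemma newton_related_Gamma : newton_related (Gamma_series R) (zetac R).
Proof.
have r0 : (0 : R) < 2^-1 by rewrite invr_gt0.
split.
  rewrite /Gamma_series /taylor_coef derive1n0 fact0 divr1 inv_Gamma1_expR ?normr0 //.
  by rewrite limn_pseries0 expR0.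
move=> k; rewrite /Gamma_series.
have derf x : `|x| < 2^-1 -> is_derive x 1 (@inv_Gamma1 R)
    (pseries_jet log_derive_coef 0 x * inv_Gamma1 x).
  by move=> x2; rewrite /pseries_jet fact0 divr1; exact: is_derive_inv_Gamma1.
have derB i (x : R) : `|x| < 2^-1 -> is_derive x 1 (pseries_jet log_derive_coef i)
    (i.+1%:R * pseries_jet log_derive_coef i.+1 x).
  move=> x2; apply: is_derive_pseries_jet; first exact: log_derive_coef_cvg.
  by lra.
rewrite (taylor_coef_log_derive r0 derf derB k).
by apply: eq_bigr => i _; rewrite pseries_jet0.
Qed.

End GammaSeries.

(** * Symmetrized multiple zeta values *)

Section DescendingSums.
Variable F : comNzRingType.
Implicit Types (ys : seq F) (s t : seq nat).

(** The truncated multiple zeta value when ys is inverses N: the exponents of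
    s are given to elements of ys in the order of ys. *)
Fixpoint nested_sum ys s : F :=
  if ys is y :: ys' then
    nested_sum ys' s + (if s is k :: s' then y ^+ k * nested_sum ys' s' else 0)
  else (s == [::])%:R.

(** An injective map from D to the positions of ys is an enumeration t of D
    together with an increasing sequence of positions. *)
Lemma inj_sum_permutations (T : finType) (la : T -> nat) ys (D : {set T}) :
  inj_sum la ys D = \sum_(t <- permutations (enum D)) nested_sum ys [seq la i | i <- t].
Proof.
elim: ys D => [|y ys IH] D /=.
  have [->|[x xD]] := set_0Vmem D; first by rewrite eqxx enum_set0 big_seq1.
  have /negPf -> : D != finset.set0 by apply/finset.set0Pn; exists x.
  rewrite big_seq big1 // => t; rewrite mem_permutations => tD.
  case: t tD => [/perm_size/=|//]; rewrite -cardE => /esym/eqP.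
  by rewrite cards_eq0 => /eqP D0; rewrite D0 inE in xD.
rewrite big_split -IH /=; congr (_ + _).
have [->|[x xD]] := set_0Vmem D; first by rewrite big_set0 enum_set0 big_seq1.
have szD : (0 < size (enum D))%N by rewrite -cardE card_gt0; apply/finset.set0Pn; exists x.
rewrite (perm_big _ (permutationsE szD)) /= big_allpairs_dep undup_id ?enum_uniq //.
rewrite [RHS]big_enum /=; apply: eq_bigr => z zD; rewrite IH mulr_sumr.
apply: perm_big; apply: perm_permutations.
rewrite -(perm_cons z) -(permPr (perm_to_rem _)) ?mem_enum //.
apply/uniq_perm; rewrite ?enum_uniq //=.
  by rewrite enum_uniq mem_enum in_setD1 eqxx.
by move=> u; rewrite inE !mem_enum in_setD1; case: eqP => // ->.
Qed.

Lemma inj_sum_perm r (la : 'I_r -> nat) ys :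
  inj_sum la ys (finset.setTfor 'I_r) =
  \sum_(s : 'S_r) nested_sum ys [seq la (s i) | i <- enum 'I_r].
Proof.
rewrite inj_sum_permutations enum_setT -enumT.
rewrite (perm_big [seq [seq s i | i <- enum 'I_r] | s : 'S_r <- enum [set: 'S_r]%SET]) /=.
  rewrite big_map enum_setT -enumT big_enum /=.
  by apply: eq_bigr => s _; rewrite -map_comp.
apply: uniq_perm; first exact: permutations_uniq.
  rewrite map_inj_in_uniq ?enum_uniq // => s s' _ _ /eq_in_map E.
  by apply/permP => i; apply: E; rewrite mem_enum.
move=> t; rewrite mem_permutations; apply/idP/mapP => [tr|[s _ ->]]; last first.
  apply: uniq_perm; [by rewrite (map_inj_uniq perm_inj) enum_uniq|exact: enum_uniq|].
  move=> i; rewrite mem_enum; apply/mapP; exists (s^-1 i)%g; rewrite ?mem_enum //.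
  by rewrite permKV.
have sz : size t = r by rewrite (perm_size tr) size_enum_ord.
have ut : uniq t by rewrite (perm_uniq tr) enum_uniq.
have inj : injective (fun i : 'I_r => nth i t i).
  move=> i j; rewrite (set_nth_default i j) ?sz // => /eqP.
  by rewrite nth_uniq ?sz // => /eqP/val_inj.
exists (perm inj); first by rewrite mem_enum inE.
case: (pickP (fun _ : 'I_r => true)) => [x0 _|none].
  apply: (@eq_from_nth _ x0); rewrite sz ?size_map -?enumT ?size_enum_ord // => i ir.
  rewrite (nth_map x0) ?size_enum_ord // permE nth_enum_ord //.
  by apply: set_nth_default; rewrite sz.
have r0 : r = 0%N by rewrite -(card_ord r) eq_card0.
transitivity (Nil 'I_r); last apply/esym; apply: size0nil; first by rewrite sz.
by rewrite size_map size_enum_ord.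
Qed.

End DescendingSums.

Section MultipleZetaLimit.
Variable R : realType.

(** Every finite subset of S lies in some A N, so the supremum that defines
    the sum is the limit of the sums over the A N. *)
Lemma esum_exhaustion (T : choiceType) (S : set T) (f : T -> R)
    (A : nat -> seq T) (L : R) :
  (forall x, 0 <= f x) -> (forall N, uniq (A N)) ->
  (forall N x, x \in A N -> S x) -> (forall N, {subset A N <= A N.+1}) ->
  (forall x, S x -> exists N, x \in A N) ->
  (fun N => \sum_(x <- A N) f x) @ \oo --> L ->
  \esum_(x in S) (f x)%:E = L%:E.
Proof.
move=> f0 uA AS Anext SA AL.
have finA N : finite_set [set` A N] by apply: finite_seq.
have sumA N : (\sum_(x \in [set` A N]) (f x)%:E)%E = (\sum_(x <- A N) f x)%:E.
  by rewrite -fsbig_seq // sumEFin.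
have mono M N : (M <= N)%N -> {subset A M <= A N}.
  elim: N => [|N IH]; first by rewrite leqn0 => /eqP ->.
  rewrite leq_eqVlt => /orP[/eqP ->//|MN] x /(IH MN); exact: Anext.
have nd : nondecreasing_seq (fun N => \sum_(x <- A N) f x).
  move=> M N MN; rewrite -lee_fin -!sumA; apply: lee_fsum_nneg_subset => //.
    by move=> x; rewrite !inE; exact: mono.
  by move=> x _; rewrite lee_fin.
apply/eqP; rewrite eq_le; apply/andP; split; last first.
  have AE N : ((\sum_(x <- A N) f x)%:E <= \esum_(x in S) (f x)%:E)%E.
    apply: esum_ge; exists [set` A N]; last by rewrite sumA.
    by split=> // x /=; exact: AS.
  case E: (\esum_(x in S) (f x)%:E) => [e| |]; rewrite ?leey //.
    rewrite lee_fin -(cvg_lim (@Rhausdorff R) AL).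
    apply: limr_le; first exact: cvgP AL.
    by apply: nearW => N; have := AE N; rewrite E lee_fin.
  by have := AE 0%N; rewrite E leeNy_eq.
apply: ge_ereal_sup => _ [X [finX XS] <-].
have [N XN] : exists N, forall x, X x -> x \in A N.
  have : forall s : seq T, {in s, forall x, S x} -> exists N, {subset s <= A N}.
    elim=> [|x s IH] sS; first by exists 0%N.
    have [M sM] := IH (fun y ys => sS y (@mem_behead _ (x :: s) y ys)).
    have [N xN] := SA x (sS x (mem_head _ _)).
    exists (maxn M N) => y; rewrite inE => /orP[/eqP ->|/sM].
      by apply: mono xN; exact: leq_maxr.
    by apply: mono; exact: leq_maxl.
  move=> /(_ (fset_set X)) [|N XN].
    by move=> x; rewrite in_fset_set // inE; exact: XS.
  by exists N => x Xx; apply: XN; rewrite in_fset_set // inE.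
apply: (@le_trans _ _ (\sum_(x \in [set` A N]) (f x)%:E)%E).
  apply: lee_fsum_nneg_subset => //.
    by move=> x; rewrite !inE /=; exact: XN.
  by move=> x _; rewrite lee_fin.
rewrite sumA lee_fin -(cvg_lim (@Rhausdorff R) AL).
exact: nondecreasing_cvgn_le nd (cvgP _ AL) N.
Qed.

Fixpoint desc_seqs N r : seq (seq nat) :=
  if N is N'.+1 then
    desc_seqs N' r ++ (if r is r'.+1 then [seq N :: s | s <- desc_seqs N' r'] else [::])
  else if r is 0 then [:: [::]] else [::].

Lemma mem_desc_seqs N r s :
  (s \in desc_seqs N r) =
  [&& size s == r, sorted gtn s & all (fun i => 0 < i <= N)%N s].
Proof.
have gtn_tr : transitive gtn by move=> y x z /= yx zy; exact: ltn_trans zy yx.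
elim: N r s => [|N IH] [|r] [|x s] //=.
- by case: x => [|x]; rewrite ?andbF.
- by rewrite cats0 IH.
- by rewrite cats0 IH.
- by rewrite mem_cat IH; apply/mapP => -[].
rewrite mem_cat IH /= !(path_sortedE gtn_tr) eqSS.
have -> : (x :: s \in [seq N.+1 :: t | t <- desc_seqs N r]) =
          (x == N.+1) && (s \in desc_seqs N r).
  apply/mapP/andP => [[t tin [-> ->]]|[/eqP -> sin]]; first by rewrite eqxx.
  by exists s.
rewrite IH; case: (size s == r) => /=; last by rewrite andbF.
case: (sorted gtn s) => /=; last by rewrite !andbF.
have [->|xN] /= := eqVneq x N.+1.
  rewrite !andbT ltnn andbF /= ltnSn /= -all_predI; apply: eq_all => i /=.
  by rewrite ltnS; case: (0 < i)%N; rewrite ?andbF //=; lia.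
have -> : (x <= N.+1)%N = (x <= N)%N by rewrite leq_eqVlt (negPf xN) ltnS.
rewrite orbF !andbT; have [xs /=|//] := boolP (all (gtn x) s).
have [x0 /=|//] := boolP (0 < x <= N)%N.
by apply: eq_in_all => i /(allP xs) /= ix; lia.
Qed.

Lemma desc_seqs_uniq N r : uniq (desc_seqs N r).
Proof.
elim: N r => [|N IH] [|r] //=; first by rewrite cats0.
rewrite cat_uniq IH /= map_inj_uniq ?IH ?andbT; last by move=> s t [].
apply/hasPn => _ /mapP[s _ ->]; rewrite mem_desc_seqs.
by apply/negP => /and3P[_ _ /= /andP[]]; rewrite ltnn.
Qed.

Lemma nested_sum_desc_seqs N (l : seq nat) :
  nested_sum (inverses R N) l =
  \sum_(s <- desc_seqs N (size l)) \prod_(i < size l) (nth 0%N s i)%:R^-1 ^+ nth 0%N l i.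
Proof.
elim: N l => [|N IH] [|k l] /=.
- by rewrite big_seq1 big_ord0.
- by rewrite big_nil.
- by rewrite cats0 addr0 IH.
rewrite big_cat big_map -(IH (k :: l)); congr (_ + _).
rewrite IH mulr_sumr; apply: eq_bigr => s _.
by rewrite big_ord_recl.
Qed.

End MultipleZetaLimit.

Section MultipleZeta.
Variable R : realType.

Lemma nested_sum_ge0 N (l : seq nat) : 0 <= nested_sum (inverses R N) l.
Proof.
elim: N l => [|N IH] [|k l] //=; first by rewrite addr0.
by rewrite addr_ge0 // mulr_ge0 // exprn_ge0 // invr_ge0.
Qed.

Lemma nested_sum_nd (l : seq nat) :
  nondecreasing_seq (fun N => nested_sum (inverses R N) l).
Proof.
apply/nondecreasing_seqP => N /=; rewrite lerDl; case: l => // k l.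
by rewrite mulr_ge0 ?nested_sum_ge0 // exprn_ge0 // invr_ge0.
Qed.

(** Dropping the condition that the indices decrease bounds a nested sum by a
    product of power sums, which stays bounded when all exponents are at least
    2. *)
Lemma nested_sum_le_prod N (l : seq nat) :
  nested_sum (inverses R N) l <= \prod_(k <- l) power_sum (inverses R N) k.
Proof.
elim: N l => [|N IH] [|k l] /=; rewrite ?big_nil //.
- by rewrite big_cons /power_sum big_nil mul0r.
- by rewrite addr0; have := IH [::]; rewrite big_nil.
rewrite big_cons power_sumS mulrDl addrC lerD //.
  rewrite ler_wpM2l ?exprn_ge0 ?invr_ge0 //; apply: le_trans (IH l) _.
  rewrite [leLHS]big_seq [leRHS]big_seq; apply: ler_prod => j _.
  by rewrite power_sum_ge0 /= power_sumS lerDr exprn_ge0 // invr_ge0.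
have := IH (k :: l); rewrite big_cons => /le_trans; apply.
rewrite ler_wpM2l ?power_sum_ge0 //.
apply: ler_prod => j _.
by rewrite power_sum_ge0 /= power_sumS lerDr exprn_ge0 // invr_ge0.
Qed.

Lemma cvg_mzeta (l : seq nat) r (t : 'I_r -> R) : size l = r ->
  (forall i : 'I_r, t i = (nth 0%N l i)%:R) -> all (leq 2) l ->
  (fun N => nested_sum (inverses R N) l) @ \oo --> mzeta t.
Proof.
move=> szl tl l2.
have cZ : cvgn (fun N => nested_sum (inverses R N) l).
  apply: nondecreasing_is_cvgn; first exact: nested_sum_nd.
  exists (\prod_(k <- l) 2) => _ [N _ <-].
  apply: le_trans (nested_sum_le_prod N l) _.
  rewrite [leLHS]big_seq [leRHS]big_seq; apply: ler_prod => k kl.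
  by rewrite power_sum_ge0 power_sum_ub //; exact: (allP l2).
pose f (n : {ffun 'I_r -> nat}) : R := \prod_(i < r) (n i)%:R `^ (- t i).
pose fs s : {ffun 'I_r -> nat} := [ffun i : 'I_r => nth 0%N s i].
pose A N := [seq fs s | s <- desc_seqs N r].
have fsK (n : {ffun 'I_r -> nat}) : fs [seq n i | i <- enum 'I_r] = n.
  by apply/ffunP => i; rewrite ffunE (nth_map i) ?size_enum_ord // nth_ord_enum.
have gtn_tr : transitive gtn by move=> y x z /= yx zy; exact: ltn_trans zy yx.
have E : \esum_(n in [set n : {ffun 'I_r -> nat} |
    (forall i j : 'I_r, (i < j)%N -> (n j < n i)%N) /\
    (forall i : 'I_r, (1 <= n i)%N)]) (f n)%:E =
  (limn (fun N => nested_sum (inverses R N) l))%:E.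
  apply: (@esum_exhaustion _ _ _ _ A).
  - by move=> n; apply: prodr_ge0 => i _; exact: powR_ge0.
  - move=> N; rewrite map_inj_in_uniq ?desc_seqs_uniq // => s s'.
    rewrite !mem_desc_seqs => /and3P[/eqP sz _ _] /and3P[/eqP sz' _ _] ss'.
    apply: (@eq_from_nth _ 0%N); rewrite sz ?sz' // => i ir.
    by have := congr1 (fun n : {ffun 'I_r -> nat} => n (Ordinal ir)) ss'; rewrite !ffunE.
  - move=> N n /mapP[s]; rewrite mem_desc_seqs => /and3P[/eqP sz ss sN] ->.
    split=> [i j ij|i]; rewrite !ffunE.
      by apply: (sorted_ltn_nth gtn_tr 0%N ss) => //; rewrite inE sz.
    have /allP/(_ (nth 0%N s i)) := sN; rewrite mem_nth ?sz // => /(_ isT).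
    by case/andP.
  - move=> N n /mapP[s]; rewrite mem_desc_seqs => /and3P[sz ss /allP sN] ->.
    apply/mapP; exists s => //; rewrite mem_desc_seqs sz ss /=.
    by apply/allP => i /sN; lia.
  - move=> n [nd n1]; exists (\max_i n i)%N; apply/mapP.
    exists [seq n i | i <- enum 'I_r]; last by rewrite fsK.
    rewrite mem_desc_seqs size_map size_enum_ord eqxx /=; apply/andP; split.
      have : sorted ltn [seq val i | i <- enum 'I_r].
        by rewrite val_enum_ord iota_ltn_sorted.
      by rewrite !sorted_map; apply: sub_sorted => i j; exact: nd.
    apply/allP => _ /mapP[i _ ->]; rewrite n1 /=.
    exact: leq_bigmax.
  rewrite (_ : (fun N => _) = (fun N => nested_sum (inverses R N) l)) //.
  apply/funext => N; rewrite /A big_map nested_sum_desc_seqs szl.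
  apply: eq_big_seq => s; rewrite mem_desc_seqs => /and3P[/eqP sz _ /allP sN].
  apply: eq_bigr => i _; rewrite ffunE tl powRN powR_mulrn ?exprVn //.
by rewrite /mzeta E.
Qed.

(** The two sides are the limits of the two expressions of the sum over
    injective maps into 1/N, ..., 1: one by rearrangements, the other by set
    partitions. *)
Lemma zetaS_moebius (la : intpart) : mult 1 la = 0%N ->
  zetaS (fun j : 'I_(plength la) => (part j)%:R : R) = moebius_sum (zetac R) la.
Proof.
move=> m1; set t := fun j => _.
have ge2 (j : 'I_(plength la)) : (2 <= part j)%N.
  have := part_gt0 j; rewrite leq_eqVlt => /orP[/eqP p1|//].
  move: m1; rewrite /mult => /eqP; rewrite -leqn0 leqNgt -has_count has_pred1.
  by rewrite p1 /part mem_nth.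
have L : (fun N => inj_sum (@part la) (inverses R N) (finset.setTfor _)) @ \oo -->
    zetaS t.
  under eq_fun do rewrite inj_sum_perm.
  apply: (cvg_big (op := +%R)); first exact: add_continuous.
  move=> s _; apply: cvg_mzeta.
  - by rewrite size_map size_enum_ord.
  - by move=> i; rewrite (nth_map i) ?size_enum_ord // nth_ord_enum.
  - by apply/allP => _ /mapP[i _ ->].
have M : (fun N => inj_sum (@part la) (inverses R N) (finset.setTfor _)) @ \oo -->
    moebius_sum (zetac R) la.
  under eq_fun do rewrite inj_sum_partition /partition_sum.
  apply: (cvg_big (op := +%R)); first exact: add_continuous.
  move=> P partP.
  have mulc : continuous (fun x : R * R => x.1 * x.2) by exact: mul_continuous.
  apply: (@cvg_big R {set 'I_(plength la)} *%R 1 (fun B => B \in P) mulc).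
  move=> B BP; apply: cvgM; first exact: cvg_cst.
  have [j jB] : exists j, j \in B.
    exact/finset.set0Pn/(partition_neq0 partP BP).
  have b2 : (2 <= block_sum B)%N.
    by rewrite /block_sum (bigD1 j) //=; have := ge2 j; lia.
  by rewrite /zetac gtn_eqF //; exact: cvg_zeta.
by rewrite -(cvg_lim (@Rhausdorff R) L) (cvg_lim (@Rhausdorff R) M).
Qed.

End MultipleZeta.

(** * Coefficients and Chern numbers of the Gamma genus *)

Lemma set_partition_sign (R : comNzRingType) r (P : {set {set 'I_r}}) :
  set_partition P ->
  \prod_(B in P) (-1) ^+ #|B|.-1 = (-1) ^+ (r - #|P|) :> R.
Proof.
move=> partP; rewrite prodrXr; congr (_ ^+ _).
have cardr := card_partition partP; rewrite cardsT card_ord in cardr.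
have -> : (r - #|P| = \sum_(B in P) #|B| - #|P|)%N by congr (_ - _)%N; exact: cardr.
rewrite -sum1_card -sumnB; last first.
  by move=> B BP; rewrite card_gt0 (partition_neq0 partP BP).
by apply: eq_bigr => B _; rewrite subn1.
Qed.

Lemma moebius_sumE (R : realType) (c : nat -> R) (la : intpart) :
  moebius_sum c la =
  \sum_(P : {set {set 'I_(plength la)}} | set_partition P)
    ((-1) ^+ (plength la - #|P|) *
     \prod_(B in P) ((#|B|.-1)`!%:R * c (block_sum B))).
Proof.
apply: eq_bigr => P partP; rewrite -(set_partition_sign R partP) -big_split /=.
by apply: eq_bigr => B _; rewrite mulrA.
Qed.

Lemma block_sum_eq1 (la : intpart) (B : {set 'I_(plength la)}) : B != finset.set0 ->
  block_sum B = 1%N <-> exists j, B = finset.set1 j /\ part j = 1%N.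
Proof.
move=> /finset.set0Pn[j jB]; split=> [B1|[i [-> pi]]]; last first.
  by rewrite /block_sum big_set1.
exists j; move: B1; rewrite /block_sum (bigD1 j) //= => B1.
have pj := part_gt0 j; split; last by lia.
apply/eqP; rewrite eq_sym finset.eqEsubset finset.sub1set jB /=; apply/fintype.subsetP => i iB.
rewrite inE; apply/negPn/negP => ij.
by move: B1; rewrite (bigD1 i) ?iB //=; have := part_gt0 i; lia.
Qed.

(** The Euler constant is at most 1, while the zeta values at integers k >= 2
    exceed 1. *)
Lemma zetac_eq_euler_gamma (R : realType) k : (0 < k)%N ->
  zetac R k = euler_gamma R <-> k = 1%N.
Proof.
move=> k0; split=> [|->]; last by rewrite /zetac eqxx.
rewrite /zetac; case: eqP => // /eqP k1 E.
have k2 : (2 <= k)%N by rewrite ltn_neqAle eq_sym k1.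
by have := zeta_gt1 R k2; rewrite E ltNge euler_gamma_le1.
Qed.

Lemma genus_coef_Gamma (R : realType) :
  genus_coef (Gamma_series R) = moebius_coef (zetac R).
Proof.
have ex := genus_expansion_moebius (newton_related_Gamma R).
apply: (@genus_expansion_inj _ (Gamma_series R)) => //.
apply: (@xgetPex _ (fun=> 0) [set b | genus_expansion (Gamma_series R) b]).
by exists (moebius_coef (zetac R)).
Qed.

(** A multiple of c_1, hence of the Chern number, vanishes, and the integers
    have no torsion. *)
Lemma chern_number_calabi_yau (M : chern_data) (la : intpart) :
  calabi_yau M -> (0 < mult 1 la)%N -> chern_number la M = 0.
Proof.
move=> [k [k0 c1k]]; rewrite /mult -has_count has_pred1 => la1.
rewrite /chern_number (perm_big _ (perm_to_rem la1)) big_cons /=.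
set x := \prod_(_ <- _) _; apply/eqP.
have /eqP : fund_eval M (chern M 1 * x) *+ k = 0.
  by rewrite -raddfMn -mulrnAl c1k mul0r raddf0.
by rewrite mulrn_eq0 eqn0Ngt k0.
Qed.

Theorem theorem5p6 (R : realType) :
  (forall la : intpart,
    [/\ genus_coef (Gamma_series R) la =
          ((mult_fact la)%:R)^-1 *
          \sum_(P : {set {set 'I_(plength la)}} | set_partition P)
            ((-1) ^+ (plength la - #|P|) *
             \prod_(B in P) ((#|B|.-1)`!%:R * zetac R (block_sum B))),
        mult 1 la = 0%N ->
          genus_coef (Gamma_series R) la =
          zetaS (fun j : 'I_(plength la) => (part j)%:R : R)
            / (mult_fact la)%:R
      & forall (P : {set {set 'I_(plength la)}}) (B : {set 'I_(plength la)}),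
          set_partition P -> B \in P ->
          (block_sum B = 1%N <->
             exists j, B = finset.set1 j /\ part j = 1%N) /\
          (zetac R (block_sum B) = euler_gamma R <->
             exists j, B = finset.set1 j /\ part j = 1%N)]) /\
  (forall M : chern_data, calabi_yau M ->
    (forall la : intpart, weight la = half_dim M -> (0 < mult 1 la)%N ->
       chern_number la M = 0) /\
    complex_genus (Gamma_series R) M =
      \sum_(la \in [set la : intpart | weight la = half_dim M /\
                                       mult 1 la = 0%N])
        (zetaS (fun j : 'I_(plength la) => (part j)%:R : R)
           / (mult_fact la)%:R) * (chern_number la M)%:~R).
Proof.
have coefS la : mult 1 la = 0%N -> genus_coef (Gamma_series R) la =
    zetaS (fun j : 'I_(plength la) => (part j)%:R : R) / (mult_fact la)%:R.
  by move=> m1; rewrite genus_coef_Gamma /moebius_coef -zetaS_moebius // mulrC.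
split=> [la|M cyM].
  split=> [||P B partP BP]; first by rewrite genus_coef_Gamma /moebius_coef moebius_sumE.
    exact: coefS.
  have B0 := partition_neq0 partP BP.
  have [j jB] : exists j, j \in B by apply/finset.set0Pn.
  split; first exact: block_sum_eq1.
  by rewrite zetac_eq_euler_gamma ?(block_sum_gt0 jB) //; exact: block_sum_eq1.
split=> [la _|]; first exact: chern_number_calabi_yau.
rewrite /complex_genus; apply: esym.
rewrite (@eq_fsbigr _ _ _ _ _ (fun la => genus_coef (Gamma_series R) la * (chern_number la M)%:~R)).
  apply: fsbig_widen => [la []//|la [/= wla nla]].
  rewrite chern_number_calabi_yau ?mulr0 //.
  by rewrite lt0n; apply/eqP => m1; apply: nla.
by move=> la; rewrite inE => -[_ m1]; rewrite coefS.
Qed.
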